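(* Let $\varepsilon>0$, $\delta\in(0,1)$, and $\gamma=\frac1\varepsilon\ln\left(\frac2\delta\right)$. Suppose the input stream $X$ and the target capacity $k$ (a positive integer) satisfy $$\frac{|X|}{2k}>2(\gamma+1).$$ Then, for a suitable choice of the capacity parameter $\tilde k$, the algorithm $\mathsf{DPSS}(X,k,\tilde k,\varepsilon,\delta)$ (defined in the context) can be implemented with $\mathcal O(k)$ words of memory and $\mathcal O(1)$ update time, and its output $(\hat{\mathcal T},\hat C)$ has the following properties. (1) For any item $x\in\hat{\mathcal T}$ with true frequency $f_x$, with probability at least $1-\delta$ (that is, the event that $x\in\hat{\mathcal T}$ and the following inequalities fail has probability at most $\delta$), $$f_x-\frac1\varepsilon\ln\frac1\delta\ \le\ \hat C[x]\ \le\ f_x+\frac{|X|}{2k}+\frac1\varepsilon\ln\frac1\delta .$$ (2) Any item $y$ with $f_y>|X|/k$ satisfies $y\in\hat{\mathcal T}$ with probability at least $1-\delta$.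
   Context: A stream $X=(x_1,\dots,x_T)$ is a sequence of items from a universe $\mathcal U$, with length $|X|=T$; the frequency of $y\in\mathcal U$ is $f_y=|\{j:x_j=y\}|$. Memory is counted in machine words (one word stores an item, a counter or a time stamp). SpaceSaving. For a positive integer $m$, $\mathsf{SS}(X,m)$ maintains a set of tracked items $\mathcal T_t$ and counters $C_t[a]$, $a\in\mathcal T_t$, starting from $\mathcal T_0=\varnothing$. On update $x_t$ (counters and tracked items not mentioned are unchanged): (1) if $x_t\in\mathcal T_{t-1}$, set $C_t[x_t]=C_{t-1}[x_t]+1$; (2) else, if $|\mathcal T_{t-1}|<m$, set $\mathcal T_t=\mathcal T_{t-1}\cup\{x_t\}$ and $C_t[x_t]=1$; (3) else, let $S_t$ be the set of $a\in\mathcal T_{t-1}$ minimizing $C_{t-1}[a]$, let $y=\arg\max_{a\in S_t}\tau_{t-1}[a]$, where $\tau_s[a]$ is the last time $r\le s$ at which item $a$ occurs in the stream, and set $\mathcal T_t=(\mathcal T_{t-1}\setminus\{y\})\cup\{x_t\}$, $C_t[x_t]=C_{t-1}[y]+1$. The output is the final pair $(\mathcal T,C)=(\mathcal T_T,C_T)$. Algorithm $\mathsf{DPSS}(X,k,\tilde k,\varepsilon,\delta)$. Let $\gamma=\frac1\varepsilon\ln\frac2\delta$, compute $(\mathcal T,C)=\mathsf{SS}(X,\tilde k)$, and let $\tau=\max\{|X|/k-\gamma,\ |X|/\tilde k+1+\gamma\}$. For each $x\in\mathcal T$ independently draw Laplace noise $\eta_x$ with scale $1/\varepsilon$ (density $\frac{\varepsilon}{2}e^{-\varepsilon|u|}$)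 and set $\hat c_x=C[x]+\eta_x$. Output $\hat{\mathcal T}=\{x\in\mathcal T:\hat c_x>\tau\}$ together with the values $\hat C[x]=\hat c_x$ for $x\in\hat{\mathcal T}$. *)

(* Defs.v *)
From HB Require Import structures.
From mathcomp Require Import all_boot all_order all_algebra finmap.
From mathcomp Require Import all_classical all_reals all_analysis.
Import numFieldNormedType.Exports.

Set Implicit Arguments.
Unset Strict Implicit.
Unset Printing Implicit Defensive.

Import Order.TTheory GRing.Theory Num.Theory.
Local Open Scope classical_set_scope.
Local Open Scope fset_scope.
Local Open Scope fmap_scope.
Local Open Scope ring_scope.

Section SpaceSaving.
Variable U : choiceType.
Implicit Types (X : seq U) (C : {fmap U -> nat}).

Definition freq X (y : U) : nat := count_mem y X.

(* Times are counted from 1; the value is 0 if [a] does not occur. *)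
Definition last_occ X (a : U) : nat :=
  (\max_(j < size X | onth X j == Some a) j.+1)%N.

(* The pair (tracked items, counters) is one finite map, whose domain is the
   set of tracked items. [X] is the part of the stream read before [x]. The
   item to evict is unique, since distinct tracked items have distinct last
   occurrences; the branch [None] is reached only for [m = 0]. *)
Definition ss_step (m : nat) X C (x : U) : {fmap U -> nat} :=
  if C.[? x] is Some c then C.[x <- c.+1]
  else if (#|` domf C| < m)%N then C.[x <- 1%N]
  else
    let S := [set a : domf C | [forall b : domf C, C a <= C b]%N]%SET in
    if [pick y in S | [forall a in S, last_occ X (val a) <= last_occ X (val y)]%N]
      is Some y then C.[~ val y].[x <- (C y).+1]
    else C.

Fixpoint ss_at (m : nat) X (t : nat) : {fmap U -> nat} :=
  if t is t'.+1 then
    if onth X t' is Some x then ss_step m (take t' X) (ss_at m X t') x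
    else ss_at m X t'
  else [fmap].

Definition SS X (m : nat) : {fmap U -> nat} := ss_at m X (size X).

End SpaceSaving.

Section DPSS.
Variables (R : realType) (U : choiceType).
Implicit Types (X : seq U) (eps delta : R) (k kt : nat).

Definition gamma eps delta : R := eps^-1 * ln (2 / delta).

Definition threshold (n k kt : nat) eps delta : R :=
  Num.max (n%:R / k%:R - gamma eps delta)
          (n%:R / kt%:R + 1 + gamma eps delta).

(* Output for given values [eta] of the noise; the pair (released items,
   released values) is again one finite map. *)
Definition DPSS X k kt eps delta (eta : U -> R) : {fmap U -> R} :=
  let C := SS X kt in
  let chat x := (odflt 0%N C.[? x])%:R + eta x in
  [fmap x : [fset x in domf C | threshold (size X) k kt eps delta < chat x]
     => chat (val x)].

Definition laplace_pdf eps (u : R) : R := eps / 2 * expR (- (eps * `|u|)).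

(* [eta x], for [x] in [D], are independent and Laplace of scale [1 / eps]. *)
Definition laplace_noise (d : measure_display) (Omega : measurableType d)
    (P : probability Omega R) eps (D : {fset U})
    (eta : U -> {RV P >-> R}) : Prop :=
  (forall x, x \in D -> forall A : set R, measurable A ->
     distribution P (eta x) A
     = (\int[lebesgue_measure]_(u in A) (laplace_pdf eps u)%:E)%E) /\
  (forall (F : {fset U}) (B : U -> set R),
     {subset F <= D} -> (forall x, measurable (B x)) ->
     P (\bigcap_(x in [set` F]) (eta x @^-1` B x))
     = (\prod_(x <- F) P (eta x @^-1` B x))%E).

End DPSS.

(* Model of computation: a random access machine with a fixed program, whose
   words are items or natural numbers (counters, times, addresses). It has
   finitely many registers and a store of cells addressed by an array number,
   fixed in the program, and one word. A cell occupies memory only while it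
   has a value. An array indexed by numbers is thus an ordinary array, and an
   array indexed by items is a dictionary (hash table) with unit cost
   operations. Items can only be copied, compared and used as addresses.
   Numbers are bounded by [fits] below, so a word cannot encode a large data
   structure. *)

(* Real expressions are evaluated only to release a noisy value; no real
   number is kept in memory. [RReg r] is the number in register [r]. *)
Inductive rexp : Type :=
  | RReg of nat
  | RConst of nat
  | REps
  | RDelta
  | RAdd of rexp & rexp
  | RSub of rexp & rexp
  | RMul of rexp & rexp
  | RDiv of rexp & rexp
  | RMax of rexp & rexp
  | RLn of rexp.

(* [Get r a i]: register [r] receives cell [i] of array [a], or 0 if that cell
   is empty; [Put a i r]: cell [i] of [a] receives register [r]; [Del a i]:
   the cell is freed. Here [i] is the register that holds the address.
   [Release r v th]: draw a fresh noise value [z]; if [v + z > th], output the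
   item in register [r] with the value [v + z]. *)
Inductive op : Type :=
  | Const of nat & nat
  | Move of nat & nat
  | Add of nat & nat & nat
  | Sub of nat & nat & nat
  | Get of nat & nat & nat
  | Put of nat & nat & nat
  | Del of nat & nat
  | Release of nat & rexp & rexp.

Inductive test : Type :=
  | Eq of nat & nat
  | Lt of nat & nat
  | Has of nat & nat.

Inductive cmd : Type :=
  | Skip
  | Op of op
  | Seq of cmd & cmd
  | If of test & cmd & cmd
  | While of test & cmd.

Section Machine.
Variables (R : realType) (U : choiceType).

Definition word : Type := (U + nat)%type.

Definition num (w : word) : nat := if w is inr n then n else 0%N.

(* [draws], the number of noise values drawn so far, and [out], the write-only
   output, are not part of the working memory. *)
Record state : Type := State {
  regs : seq word;
  cells : {fmap nat * word -> word};
  draws : nat;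
  out : seq (U * R) }.

Definition reg (s : state) (r : nat) : word := nth (inr 0%N) (regs s) r.

Definition set_reg (s : state) (r : nat) (w : word) : state :=
  State (set_nth (inr 0%N) (regs s) r w) (cells s) (draws s) (out s).

Definition set_cells (s : state) (M : {fmap nat * word -> word}) : state :=
  State (regs s) M (draws s) (out s).

(* [xi j] is the value of the [j]-th noise draw. *)
Variables (eps delta : R) (xi : nat -> R).

Fixpoint reval (s : state) (e : rexp) : R :=
  match e with
  | RReg r => (num (reg s r))%:R
  | RConst n => n%:R
  | REps => eps
  | RDelta => delta
  | RAdd a b => reval s a + reval s b
  | RSub a b => reval s a - reval s b
  | RMul a b => reval s a * reval s b
  | RDiv a b => reval s a / reval s b
  | RMax a b => Num.max (reval s a) (reval s b)
  | RLn a => ln (reval s a)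
  end.

Definition op_eval (o : op) (s : state) : state :=
  match o with
  | Const r n => set_reg s r (inr n)
  | Move r q => set_reg s r (reg s q)
  | Add r p q => set_reg s r (inr (num (reg s p) + num (reg s q))%N)
  | Sub r p q => set_reg s r (inr (num (reg s p) - num (reg s q))%N)
  | Get r a i => set_reg s r (odflt (inr 0%N) (cells s).[? (a, reg s i)])
  | Put a i r => set_cells s (cells s).[(a, reg s i) <- reg s r]
  | Del a i => set_cells s (cells s).[~ (a, reg s i)]
  | Release r v th =>
      let z := reval s v + xi (draws s) in
      State (regs s) (cells s) (draws s).+1
        (if reg s r is inl x then
           if reval s th < z then rcons (out s) (x, z) else out s
         else out s)
  end.

Definition test_eval (b : test) (s : state) : bool :=
  match b with
  | Eq p q => reg s p == reg s q
  | Lt p q => (num (reg s p) < num (reg s q))%N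
  | Has a i => (a, reg s i) \in domf (cells s)
  end.

(* [exec c s tr]: started in [s], [c] terminates, and [tr] lists the states
   reached after each of its elementary steps (operations and tests). The
   running time is [size tr] and the final state is [last s tr]. *)
Inductive exec : cmd -> state -> seq state -> Prop :=
  | exec_skip s : exec Skip s [::]
  | exec_op o s : exec (Op o) s [:: op_eval o s]
  | exec_seq c1 c2 s t1 t2 :
      exec c1 s t1 -> exec c2 (last s t1) t2 -> exec (Seq c1 c2) s (t1 ++ t2)
  | exec_if b c1 c2 s t :
      exec (if test_eval b s then c1 else c2) s t ->
      exec (If b c1 c2) s (s :: t)
  | exec_while_false b c s :
      ~~ test_eval b s -> exec (While b c) s [:: s]
  | exec_while_true b c s t1 t2 :
      test_eval b s -> exec c s t1 -> exec (While b c) (last s t1) t2 ->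
      exec (While b c) s (s :: t1 ++ t2).

Definition init (k kt : nat) : state :=
  State [:: inr k; inr kt] [fmap] 0%N [::].

(* Before each update the next stream item is put into register 2. *)
Definition input (x : U) (s : state) : state := set_reg s 2 (inl x).

(* [trs] lists, for each item of the stream, the trace of its update, and
   [s'] is the final state. *)
Inductive process (upd : cmd) :
    state -> seq U -> seq (seq state) -> state -> Prop :=
  | process_nil s : process upd s [::] [::] s
  | process_cons x X s tr trs s' :
      exec upd (input x s) tr ->
      process upd (last (input x s) tr) X trs s' ->
      process upd s (x :: X) ((input x s :: tr) :: trs) s'.

(* An occupied cell counts for two words, its address and its value. *)
Definition space (s : state) : nat :=
  (size (regs s) + 2 * #|` domf (cells s)|)%N.

(* The state occupies at most [m] words, each holding an item or a number that
   is at most [n]. *)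
Definition fits (m n : nat) (s : state) : bool :=
  [&& (space s <= m)%N, all (fun w => num w <= n)%N (regs s) &
      [forall p : domf (cells s),
         (num (val p).2 <= n)%N && (num (cells s p) <= n)%N]].

End Machine.

(* The program formed of [upd], run on each stream item, and [rep], run after
   the last one, implements DPSS on [X] with at most [m] words of memory at
   all times and at most [t] steps per update, with words of the size of the
   counters and time stamps of the stream. Each tracked item [x] receives its
   own draw, with an index [sigma x] that does not depend on the noise values;
   hence for independent identically distributed draws the output of the
   machine has the law of the output of DPSS. *)
Definition implements_DPSS (R : realType) (U : choiceType) (upd rep : cmd)
    (m t : nat) (X : seq U) (k kt : nat) (eps delta : R) : Prop :=
  exists sigma : U -> nat,
    {in domf (SS X kt) &, injective sigma} /\
    forall xi : nat -> R,
    exists (trs : seq (seq (state R U))) (s : state R U) (tr : seq (state R U)),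
      [/\ process eps delta xi upd (init R U k kt) X trs s,
          exec eps delta xi rep s tr,
          all (fun u => size u <= t)%N trs,
          all (fits m (size X)) (flatten trs ++ tr) &
          let o := out (last s tr) in
          uniq (unzip1 o) /\
          forall x v, (x, v) \in o <->
            (DPSS X k kt eps delta (xi \o sigma)).[? x] = Some v].

(* Main.v *)
(* The capacity is kt = 2k. As the counters sum to |X|, the least counter of a
   full table is at most |X| / kt, and this bounds both the overestimate of a
   tracked item and the frequency of an untracked one. Laplace noise stays in
   [-t, t] with probability 1 - exp(- eps t); take t = ln(1/delta) / eps for the
   accuracy and t = gamma for the heavy items, for which the hypothesis on |X|
   makes |X| / k - gamma the larger of the two thresholds.

   For constant update time, the items with the same counter c form a doubly
   linked list ordered from the most recent to the oldest occurrence. An update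
   takes at most one item out of the list of some c and puts the current item at
   the front of the list of c + 1, so the lists stay ordered by themselves, the
   item to evict is the front of the list of the least counter m, and m increases
   by one when this list becomes empty. *)

Require Import Defs.
From mathcomp Require Import all_boot all_order all_algebra finmap.
From mathcomp Require Import all_classical all_reals all_analysis.
From mathcomp Require Import measurable_realfun zify ring lra.
Import Order.TTheory GRing.Theory Num.Theory.
Import numFieldNormedType.Exports.
Set Implicit Arguments.
Unset Strict Implicit.
Unset Printing Implicit Defensive.
Local Open Scope classical_set_scope.
Local Open Scope fmap_scope.
Local Open Scope ring_scope.

(* [num] alone denotes a projection of [interval_inference] here. *)
Local Notation num := Defs.num.

(** * SpaceSaving: eviction by recency and the invariants of the counters *)

Section SpaceSaving.
Local Open Scope fset_scope.
Local Open Scope nat_scope.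
Variable U : choiceType.
Implicit Types (X : seq U) (C : {fmap U -> nat}).

(** [undup] keeps the last copy of each item, so its reversal runs from the most recent to the
    oldest last occurrence. *)
Definition recent X := rev (undup X).

(** The abstract content of the linked list of counter value [c]; as a filter of [recent], it
    inherits the order by recency. *)
Definition bucket X C c := [seq a <- recent X | C.[? a] == Some c].

Lemma recent_rcons X x :
  recent (rcons X x) = x :: [seq y <- recent X | y != x].
Proof. by rewrite /recent undup_rcons rev_rcons filter_rev. Qed.

Lemma mem_recent X : recent X =i X.
Proof. by move=> a; rewrite mem_rev mem_undup. Qed.

Lemma uniq_recent X : uniq (recent X).
Proof. by rewrite rev_uniq undup_uniq. Qed.

Lemma mem_bucket X C c a :
  (a \in bucket X C c) = (C.[? a] == Some c) && (a \in X).
Proof. by rewrite mem_filter mem_recent. Qed.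

Lemma uniq_bucket X C c : uniq (bucket X C c).
Proof. exact/filter_uniq/uniq_recent. Qed.

Lemma last_occ_rcons X x a :
  last_occ (rcons X x) a = if a == x then (size X).+1 else last_occ X a.
Proof.
rewrite /last_occ size_rcons big_mkcond big_ord_recr /=.
have -> : onth (rcons X x) (size X) = Some x by rewrite -cats1 onth_cat ltnn subnn.
rewrite (eq_bigr (fun i : 'I_(size X) => if onth X i == Some a then i.+1 else 0)).
  rewrite -big_mkcond [Some x == _]eq_sym (inj_eq Some_inj).
  case: eqP => _; last by rewrite maxn0.
  by apply/maxn_idPr/bigmax_leqP => i _; rewrite ltnW // ltnS.
by move=> i _; rewrite -cats1 onth_cat ltn_ord.
Qed.

Lemma last_occ_le X a : last_occ X a <= size X.
Proof. by apply/bigmax_leqP => i _. Qed.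

Lemma recent_sorted X :
  pairwise (fun a b => last_occ X b < last_occ X a) (recent X).
Proof.
elim/last_ind: X => [//|X x IH]; rewrite recent_rcons pairwise_cons.
apply/andP; split.
  apply/allP => y; rewrite mem_filter => /andP[yx _].
  by rewrite !last_occ_rcons eqxx (negPf yx) ltnS last_occ_le.
apply: (sub_in_pairwise (P := predC1 x) (r := fun a b => last_occ X b < last_occ X a)).
- by move=> a b ax bx; rewrite !last_occ_rcons (negPf ax) (negPf bx).
- exact: filter_all.
- exact: pairwise_filter.
Qed.

Lemma ss_at_rcons m X x t : t <= size X -> ss_at m (rcons X x) t = ss_at m X t.
Proof.
elim: t => //= t IH tX; rewrite IH; last exact: ltnW.
by rewrite -cats1 onth_cat tX takel_cat // ltnW.
Qed.

Lemma SS_rcons m X x : SS (rcons X x) m = ss_step m X (SS X m) x.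
Proof.
rewrite /SS size_rcons /= ss_at_rcons // -cats1 onth_cat ltnn subnn /=.
by rewrite take_size_cat.
Qed.

(** A hit is written as a removal followed by an insertion so that it has the shape of an eviction,
    with [y = x]. Both cases then share one invariant proof and the same list operations. *)
Variant ss_step_spec m X C x : {fmap U -> nat} -> Prop :=
| SSHit c of C.[? x] = Some c : ss_step_spec m X C x C.[~ x].[x <- c.+1]
| SSNew of C.[? x] = None & #|` domf C| < m : ss_step_spec m X C x C.[x <- 1]
| SSEvict y c s of C.[? x] = None & #|` domf C| = m &
    bucket X C c = y :: s & (forall a b, C.[? a] = Some b -> c <= b) :
    ss_step_spec m X C x C.[~ y].[x <- c.+1].

(** Last occurrences strictly decrease along a bucket, so the most recent item of least counter is
    the head of the bucket of that counter. *)
Lemma ss_stepP m X C x : 0 < m -> #|` domf C| <= m ->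
  {subset domf C <= X} -> ss_step_spec m X C x (ss_step m X C x).
Proof.
move=> m0 Cm CX; rewrite /ss_step.
case Cx: C.[? x] => [c|]; first by rewrite -setf_rem1; constructor.
case: ltnP => Cm'; first by constructor.
have Em : #|` domf C| = m by apply/eqP; rewrite eqn_leq Cm.
have /fset0Pn[a0 a0C] : domf C != fset0 by rewrite -cardfs_gt0 Em.
pose a1 : domf C := [` a0C]; pose b := [arg min_(i < a1) C i]%N.
have bmin : forall i : domf C, C b <= C i.
  by rewrite /b; case: arg_minnP => // i _ H j; exact: H.
have minP a d : C.[? a] = Some d -> C b <= d.
  by case: fndP => // aC [<-].
have : val b \in bucket X C (C b).
  by rewrite mem_bucket Some_fnd eqxx CX // fsvalP.
case Eb: (bucket X C (C b)) => [//|y s] _.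
have : y \in bucket X C (C b) by rewrite Eb mem_head.
rewrite mem_bucket => /andP[/eqP Cy yX].
have yC : y \in domf C by rewrite -fndSome Cy.
have Cy' : C [` yC] = C b by move: Cy; rewrite in_fnd => -[].
(* The equality case makes the maximizer unique, so whatever [pick] returns is [y]. *)
have ymax z : C.[? z] = Some (C b) -> last_occ X z <= last_occ X y ?= iff (z == y).
  move=> Cz; have zC : z \in domf C by rewrite -fndSome Cz.
  have : z \in bucket X C (C b) by rewrite mem_bucket Cz eqxx CX.
  rewrite Eb inE; case: eqVneq => [->//|zy] /= zs; first exact/leqif_refl.
  have := pairwise_filter (fun a => C.[? a] == Some (C b)) (recent_sorted X).
  rewrite -/(bucket X C (C b)) Eb pairwise_cons => /andP[/allP/(_ _ zs) lt _].
  by split; [exact: ltnW|rewrite ltn_eqF].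
case: pickP => [y' /andP[]|/(_ [` yC])].
  rewrite inE => /forallP/(_ b) y'b /forall_inP H.
  have Cy'b : C y' = C b by apply/eqP; rewrite eqn_leq y'b bmin.
  have Fy' : C.[? val y'] = Some (C b) by rewrite -Cy'b Some_fnd.
  have : last_occ X y <= last_occ X (val y').
    by apply: (H [` yC]); rewrite inE; apply/forallP => i; rewrite Cy'.
  rewrite (geq_leqif (ymax _ Fy')) => /eqP ->; rewrite Cy'b.
  exact: SSEvict Eb _.
(* [pick] cannot fail, since [y] itself qualifies. *)
rewrite inE /=; case: forallP => [_|[]]; last by move=> i; rewrite Cy'.
move=> /forall_inPn[z]; rewrite inE => /forallP/(_ b) zb.
case/negP; apply: ymax; rewrite -Some_fnd; congr Some.
by apply/eqP; rewrite eqn_leq zb bmin.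
Qed.

(* A nonzero overestimate [e] stems from the least counter at some eviction,
   and the least counter of a full table never decreases. *)
Definition slack m C e :=
  e = 0 \/ #|` domf C| = m /\ forall a c, C.[? a] = Some c -> e <= c.

(** The truncated subtraction in [ss_upper] is exact by [ss_lower]. Slack bounds overestimates and
    untracked frequencies alike, since an eviction turns one into the other. *)
Record ss_inv m X C : Prop := SSInv {
  ss_card : #|` domf C| <= m;
  ss_sub : {subset domf C <= X};
  ss_pos : forall a c, C.[? a] = Some c -> 0 < c;
  ss_sum : \sum_(a <- domf C) odflt 0 C.[? a] = size X;
  ss_lower : forall a c, C.[? a] = Some c -> freq X a <= c;
  ss_upper : forall a c, C.[? a] = Some c -> slack m C (c - freq X a);
  ss_untracked : forall a, C.[? a] = None -> slack m C (freq X a) }.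

Lemma freq_rcons X x a : freq (rcons X x) a = freq X a + (x == a).
Proof. by rewrite /freq -cats1 count_cat /= addn0. Qed.

Lemma fnd_set_rem1 C y x (v : nat) a : C.[~ y].[x <- v].[? a] =
  if a == x then Some v else if a == y then None else C.[? a].
Proof. by rewrite fnd_set fnd_rem1; case: (a == y). Qed.

Lemma domf_rem1 C y : domf C.[~ y] = domf C `\ y.
Proof.
apply/fsetP => a; rewrite -fndSome fnd_rem1 in_fsetD1.
by case: eqP => //= _; rewrite fndSome.
Qed.

Lemma domf_set_rem1 C y x (v : nat) :
  domf C.[~ y].[x <- v] = x |` (domf C `\ y).
Proof. by rewrite dom_setf domf_rem1. Qed.

Lemma card_set_rem1 C y x c (v : nat) :
  C.[? y] = Some c -> C.[~ y].[? x] = None ->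
  #|` domf C.[~ y].[x <- v]| = #|` domf C|.
Proof.
move=> Cy Cx; have yC : y \in domf C by rewrite -fndSome Cy.
have xC : x \notin domf C `\ y.
  by rewrite -domf_rem1 -fndSome Cx.
by rewrite domf_set_rem1 cardfsU1 xC (cardfsD1 y (domf C)) yC.
Qed.

Lemma sum_setf C x (v : nat) : C.[? x] = None ->
  \sum_(a <- domf C.[x <- v]) odflt 0 C.[x <- v].[? a] =
  v + \sum_(a <- domf C) odflt 0 C.[? a].
Proof.
move=> Cx; have xC : x \notin domf C by rewrite -fndSome Cx.
pose F a := odflt 0 C.[x <- v].[? a].
transitivity (\sum_(a <- x |` domf C) F a); first by rewrite -(dom_setf C x v).
rewrite big_fsetU1 //= {1}/F fnd_set eqxx; congr (_ + _).
apply: eq_big_seq => a aC; rewrite /F fnd_set; case: eqP => // ax.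
by rewrite -ax aC in xC.
Qed.

Lemma sum_rem1 C y c : C.[? y] = Some c ->
  \sum_(a <- domf C) odflt 0 C.[? a] =
  c + \sum_(a <- domf C.[~ y]) odflt 0 C.[~ y].[? a].
Proof.
move=> Cy; have yC : y \in domf C by rewrite -fndSome Cy.
rewrite (big_fsetD1 y) //= Cy; congr (_ + _).
pose F a := odflt 0 C.[~ y].[? a].
rewrite -[RHS]/(\sum_(a <- domf C.[~ y]) F a) domf_rem1.
apply: eq_big_seq => a; rewrite !inE /F fnd_rem1 => /andP[ay _].
by rewrite ay.
Qed.

Lemma fnd_le_sum C a c :
  C.[? a] = Some c -> c <= \sum_(a <- domf C) odflt 0 C.[? a].
Proof. by move=> /sum_rem1 ->; apply: leq_addr. Qed.

(** Averaging: a full table has [m] counters, each at least [e]. With [ss_sum] this bounds [e] by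
    $|X|/m$. *)
Lemma slackP m C e : slack m C e ->
  e * m <= \sum_(a <- domf C) odflt 0 C.[? a].
Proof.
case=> [->//|[<- H]].
have -> : e * #|` domf C| = \sum_(a <- domf C) e.
  by rewrite big_const_seq count_predT iter_addn_0.
rewrite big_seq [X in _ <= X]big_seq.
apply: leq_sum => a; rewrite -fndSome.
by case Ca: C.[? a] => [c|//] _; apply: H Ca.
Qed.

Lemma ss_inv_nil m : ss_inv m [::] [fmap].
Proof.
split.
- by rewrite cardfs0.
- by move=> a; rewrite in_fset0.
- by move=> a c; rewrite fnd_fmap0.
- by rewrite big_seq_fset0.
- by move=> a c; rewrite fnd_fmap0.
- by move=> a c; rewrite fnd_fmap0.
by move=> a _; left.
Qed.

(** Covers hits, where [x = y], and evictions. The new counter exceeds the removed one and the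
    number of entries is unchanged, so slack is preserved. *)
Lemma ss_inv_set_rem1 m X C y x c : ss_inv m X C ->
  C.[? y] = Some c -> C.[~ y].[? x] = None -> x = y \/ #|` domf C| = m /\ 
  (forall a b, C.[? a] = Some b -> c <= b) ->
  ss_inv m (rcons X x) C.[~ y].[x <- c.+1].
Proof.
move=> [cC sC pC sumC lC uC nC] Cy Cx xy.
have cC' := card_set_rem1 c.+1 Cy Cx.
have slack_step e : slack m C e -> slack m C.[~ y].[x <- c.+1] e.
  case=> [->|[Em H]]; [by left | right; split; first by rewrite cC'].
  move=> a d; rewrite fnd_set_rem1; case: eqP => _ [].
    by move=> <-; apply/leqW/(H _ _ Cy).
  by case: eqP => // _ /H.
have C0 a : C.[? a] = None -> a != y by case: eqP => // ->; rewrite Cy.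
split.
- by rewrite cC'.
- move=> a; rewrite domf_set_rem1 mem_rcons !inE => /orP[->//|/andP[_ /sC ->]].
  by rewrite orbT.
- move=> a d; rewrite fnd_set_rem1; case: eqP => _; first by case=> <-.
  by case: eqP => // _ /pC.
- by rewrite sum_setf // size_rcons -sumC (sum_rem1 Cy) addSn.
- move=> a d; rewrite fnd_set_rem1 freq_rcons eq_sym; case: eqP => [<-|ax].
    case=> <-; rewrite addn1 ltnS.
    case: xy => [->|[Em H]]; first exact: lC Cy.
    (* On eviction [x] is untracked unless it equals [y]; an untracked frequency is zero or at most
       every counter, in particular [c]. *)
    case Fx: C.[? x] => [b|].
      move: Cx; rewrite fnd_rem1; case: eqP => [->|_]; first by rewrite (lC _ _ Cy).
      by rewrite Fx.
    by case: (nC _ Fx) => [->//|[_]]; apply; exact: Cy.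
  by case: eqP => // _ /lC; rewrite addn0.
- move=> a d; rewrite fnd_set_rem1 freq_rcons eq_sym; case: eqP => [<-|ax].
    case=> <-; rewrite addn1 subSS.
    case: xy => [E|[Em H]]; first by apply: slack_step; rewrite E; exact: uC.
    (* The overestimate of the newcomer is at most the evicted counter [c], the least one. *)
    apply: slack_step; right; split=> // a' d' /H; lia.
  by case: eqP => // _ Ca; rewrite addn0; apply: slack_step; exact: uC.
move=> a; rewrite fnd_set_rem1 freq_rcons eq_sym; case: eqP => // ax.
rewrite addn0; case: eqP => [E _|_ Ca]; last by apply: slack_step; exact: nC.
rewrite E; case: xy => [xy|[Em H]]; first by case: ax; rewrite xy E.
(* The evicted item has frequency at most its own counter, which is the least. *)
by apply: slack_step; right; split=> // a' d' /H; apply: leq_trans (lC _ _ Cy).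
Qed.

(** Before the table is full every slack is zero: counters are exact and untracked items have not
    occurred. *)
Lemma ss_inv_set m X C x : ss_inv m X C ->
  C.[? x] = None -> #|` domf C| < m -> ss_inv m (rcons X x) C.[x <- 1].
Proof.
move=> [cC sC pC sumC lC uC nC] Cx ltm.
have xC : x \notin domf C by rewrite -fndSome Cx.
have slack_step e : slack m C e -> e = 0.
  by case=> [//|[]]; move: ltm => /[swap] ->; rewrite ltnn.
split.
- by rewrite dom_setf cardfsU1 xC.
- move=> a; rewrite mem_setf mem_rcons !inE => /orP[->//|/sC ->].
  by rewrite orbT.
- move=> a d; rewrite fnd_set; case: eqP => _; first by case=> <-.
  by move/pC.
- by rewrite sum_setf // size_rcons sumC.
- move=> a d; rewrite fnd_set freq_rcons eq_sym; case: eqP => [<-|ax].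
    by case=> <-; have /nC/slack_step -> := Cx.
  by rewrite addn0; apply: lC.
- move=> a d; rewrite fnd_set freq_rcons eq_sym; case: eqP => [<-|ax].
    by case=> <-; left; lia.
  by move=> /uC/slack_step H; left; rewrite addn0.
move=> a; rewrite fnd_set freq_rcons eq_sym; case: eqP => // ax.
by rewrite addn0 => /nC/slack_step ->; left.
Qed.

Lemma ss_inv_step m X C x : 0 < m -> ss_inv m X C ->
  ss_inv m (rcons X x) (ss_step m X C x).
Proof.
move=> m0 I; case: (ss_stepP x m0 (ss_card I) (ss_sub I)) => [c Cx|Cx Cm|y c s Cx Cm By H].
- by apply: (ss_inv_set_rem1 I Cx); [rewrite fnd_rem1 eqxx|left].
- exact: ss_inv_set.
have : y \in bucket X C c by rewrite By mem_head.
rewrite mem_bucket => /andP[/eqP Cy _].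
apply: (ss_inv_set_rem1 I Cy); last by right.
by rewrite fnd_rem1 Cx; case: eqP.
Qed.

Lemma ss_invP m X : 0 < m -> ss_inv m X (SS X m).
Proof.
move=> m0; elim/last_ind: X => [|X x IH]; first exact: ss_inv_nil.
by rewrite SS_rcons; apply: ss_inv_step.
Qed.

End SpaceSaving.

(** * Laplace mass of a symmetric interval *)

Section Laplace.
Variable R : realType.
Implicit Types eps t : R.

Lemma laplace_pdf_ge0 eps (u : R) : 0 < eps -> 0 <= laplace_pdf eps u.
Proof. by move=> e0; rewrite mulr_ge0 ?expR_ge0 // divr_ge0 // ltW. Qed.

Lemma continuous_laplace_pdf eps : continuous (laplace_pdf eps : R^o -> R^o).
Proof.
move=> u; apply: cvgM; first exact: cvg_cst.
apply: continuous_comp; last exact: continuous_expR.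
apply: cvgN; apply: cvgM; first exact: cvg_cst.
exact: norm_continuous.
Qed.

Lemma measurable_laplace_pdf eps (D : set R) : measurable D ->
  measurable_fun D (EFin \o laplace_pdf eps).
Proof.
move=> mD; apply/measurable_EFinP; apply: measurable_funTS.
by apply: continuous_measurable_fun; exact: continuous_laplace_pdf.
Qed.

(** On the nonnegative half-line the Laplace density is half the exponential density. *)
Lemma integral_laplace_pdf_itv0c eps t : 0 < eps -> 0 < t ->
  (\int[lebesgue_measure]_(u in `[0%R, t]) (laplace_pdf eps u)%:E =
   (2^-1 * (1 - expR (- (eps * t))))%:E)%E.
Proof.
move=> e0 t0.
rewrite EFinM EFinB -mulNr -(exponential_prob_itv0c _ t0) /exponential_prob.
rewrite -ge0_integralZl_EFin //=.
- apply: eq_integral => u; rewrite inE /= in_itv /= => /andP[u0 _].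
  rewrite exponential_pdfE // -EFinM; congr (EFin _).
  by rewrite /laplace_pdf ger0_norm // mulNr; lra.
- move=> u; rewrite /= in_itv /= => /andP[u0 _].
  by rewrite lee_fin exponential_pdfE // mulr_ge0 ?expR_ge0 // ltW.
- apply/measurable_EFinP; apply: measurable_funTS.
  exact: measurable_exponential_pdf.
Qed.

Lemma integral_laplace_pdf_itv eps t : 0 < eps -> 0 < t ->
  (\int[lebesgue_measure]_(u in `[(- t)%R, t]) (laplace_pdf eps u)%:E =
   (1 - expR (- (eps * t)))%:E)%E.
Proof.
move=> e0 t0.
have -> : `[(- t)%R, t]%classic = (`[(- t)%R, 0%R[ `|` `[0%R, t])%classic.
  by rewrite -itv_bndbnd_setU // bnd_simp ?oppr_le0 ltW.
rewrite ge0_integral_setU //=; first last.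
- by apply/disj_setPS => u [] /=; rewrite !in_itv /= => /andP[_ u0] /andP[]; lra.
- by move=> u _; rewrite lee_fin laplace_pdf_ge0.
- by apply: measurable_laplace_pdf; exact: measurableU.
rewrite integral_itv_bndo_bndc; last exact: measurable_laplace_pdf.
(* Gives the negative half the form required by the substitution $u\mapsto -u$; the density is
   even. *)
have -> : (0%R : R) = - 0 by rewrite oppr0.
rewrite integration_by_substitution_oppr ?ltW //; last first.
  by apply: continuous_subspaceT; exact: continuous_laplace_pdf.
have -> : (laplace_pdf eps \o -%R)%R = laplace_pdf eps.
  by apply/funext => u /=; rewrite /laplace_pdf normrN.
rewrite oppr0 !integral_laplace_pdf_itv0c // -EFinD; congr (EFin _); lra.
Qed.

End Laplace.

(** * Accuracy of released values and detection of heavy items *)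

Lemma fnd_DPSS (R : realType) (U : choiceType) (X : seq U) k kt
    (eps delta : R) (eta : U -> R) x :
  (DPSS X k kt eps delta eta).[? x] =
  if (SS X kt).[? x] is Some c then
    if threshold (size X) k kt eps delta < c%:R + eta x
    then Some (c%:R + eta x) else None
  else None.
Proof.
rewrite /DPSS; case: fndP => xD.
  rewrite ffunE /=; move: (xD); rewrite !inE /= -fndSome.
  by case: (SS X kt).[? x] => [c|//] /= ->.
move: xD; rewrite !inE /= -fndSome.
by case: (SS X kt).[? x] => [c|//] /= /negPf ->.
Qed.

Section Accuracy.
Local Open Scope fset_scope.
Local Open Scope ring_scope.
Variables (R : realType) (U : choiceType) (eps delta : R).
Variables (d : measure_display) (Omega : measurableType d).
Variables (P : probability Omega R).
Hypothesis eps_gt0 : 0 < eps.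

Lemma laplace_noise_ge D (eta : U -> {RV P >-> R}) x (t : R) (A : set R) :
  laplace_noise eps D eta -> x \in D -> 0 < t -> measurable A ->
  (`[- t, t] `<=` A)%classic ->
  ((1 - expR (- (eps * t)))%:E <= P (eta x @^-1` A))%E.
Proof.
move=> [law _] xD t0 mA tA.
have := law _ xD A mA; rewrite /distribution /pushforward => ->.
rewrite -integral_laplace_pdf_itv //; apply: ge0_subset_integral => //.
- exact: measurable_laplace_pdf.
- by move=> u _; rewrite lee_fin laplace_pdf_ge0.
Qed.


Lemma DPSS_accuracy X k kt (eta : U -> {RV P >-> R}) x :
  0 < delta < 1 -> (0 < k)%N -> (2 * k <= kt)%N ->
  laplace_noise eps (domf (SS X kt)) eta ->
  (P [set w | exists2 v,
         (DPSS X k kt eps delta (fun x => eta x w)).[? x] = Some v &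
         ~ ((freq X x)%:R - eps^-1 * ln (delta^-1) <= v
            <= (freq X x)%:R + (size X)%:R / (2 * k%:R)
               + eps^-1 * ln (delta^-1))%R]
   <= delta%:E)%E.
Proof.
move=> /andP[d0 d1] k0 kkt noise.
have kt0 : (0 < kt)%N by lia.
have := ss_invP X kt0; move: noise; set C := SS X kt => noise inv.
case Cx: C.[? x] => [c|]; last first.
  rewrite [X in P X](_ : _ = set0) ?measure0 ?lee_fin ?ltW //.
  by rewrite -subset0 => w [v]; rewrite fnd_DPSS -/C Cx.
have xC : x \in domf C by rewrite -fndSome Cx.
set t := eps^-1 * _; set up := _ / _.
have t0 : 0 < t by rewrite mulr_gt0 ?invr_gt0 // ln_gt0 // invf_gt1.
have lo : (freq X x)%:R <= c%:R :> R by rewrite ler_nat (ss_lower inv Cx).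
(* By [slackP] the overestimate times [kt] is at most $|X|$, and [kt] is at least $2k$. *)
have hi : c%:R <= (freq X x)%:R + up.
  have := slackP (ss_upper inv Cx); rewrite (ss_sum inv) => H.
  rewrite /up -lerBlDl -natrB ?(ss_lower inv Cx) // -natrM.
  rewrite ler_pdivlMr ?ltr0n ?muln_gt0 // -natrM ler_nat.
  by apply: leq_trans H; rewrite leq_mul2l kkt orbT.
set th := threshold (size X) k kt eps delta.
(* The good noise values: either [x] is not released or its value lies in the claimed range. *)
pose A := ~` (`]th - c%:R, +oo[ `&`
  ~` `[(freq X x)%:R - t - c%:R, (freq X x)%:R + up + t - c%:R])%classic.
have mA : measurable A.
  by apply/measurableC/measurableI => //; apply: measurableC.
rewrite [X in P X](_ : _ = ~` (eta x @^-1` A))%classic; last first.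
  apply/seteqP; split => w /=; rewrite fnd_DPSS -/C Cx -/th.
    move=> [v]; case: ifP => // ltth [<-] /negP H.
    apply; split; rewrite /= in_itv /= ?andbT; first by lra.
    by apply/negP; apply: contra H => /andP[H1 H2]; apply/andP; split; lra.
  move=> /contrapT[]; rewrite /= !in_itv /= andbT => ltth H.
  exists (c%:R + eta x w); first by rewrite -ltrBlDl ltth.
  by move=> /andP[H1 H2]; apply: H; apply/andP; split; lra.
have mE : measurable (eta x @^-1` A).
  by rewrite -[X in measurable X]setTI; apply: measurable_funP.
rewrite probability_setC // leeBlDr ?fin_num_measure // -leeBlDl //.
(* The choice of [t] makes $e^{-\varepsilon t}=\delta$. *)
have -> : (1 - delta%:E = (1 - expR (- (eps * t)))%:E)%E.
  by rewrite /t mulVKf ?gt_eqF // lnV ?posrE // opprK lnK ?posrE.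
apply: (laplace_noise_ge noise xC t0 mA) => u /=.
rewrite in_itv /= => /andP[u1 u2] [_]; apply.
by rewrite /= in_itv /=; apply/andP; split; lra.
Qed.

Lemma DPSS_heavy X k (eta : U -> {RV P >-> R}) y :
  0 < delta < 1 -> (0 < k)%N ->
  (size X)%:R / (2 * k%:R) > 2 * (gamma eps delta + 1) ->
  laplace_noise eps (domf (SS X (2 * k))) eta ->
  (freq X y)%:R > (size X)%:R / k%:R :> R ->
  ((1 - delta)%:E <= P [set w | y \in
     domf (DPSS X k (2 * k) eps delta (fun x => eta x w))])%E.
Proof.
move=> /andP[d0 d1] k0 big; set kt := (2 * k)%N.
have kt0 : (0 < kt)%N by lia.
have := ss_invP X kt0; set C := SS X kt => inv noise heavy.
have k0R : 0 < k%:R :> R by rewrite ltr0n.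
(* An untracked [y] would have frequency at most $|X|/(2k)$, so it would not be heavy. *)
case Cy: C.[? y] => [c|]; last first.
  have := slackP (ss_untracked inv Cy); rewrite (ss_sum inv) => H.
  move: heavy; rewrite ltr_pdivrMr // -natrM ltr_nat ltnNge => /negP[].
  by apply: leq_trans H; rewrite leq_mul2l /kt leq_pmull // orbT.
have yC : y \in domf C by rewrite -fndSome Cy.
have g0 : 0 < gamma eps delta.
  by rewrite mulr_gt0 ?invr_gt0 // ln_gt0 // ltr_pdivlMr // mul1r; lra.
(* The two thresholds differ by $|X|/(2k)-1-2\gamma$, which is positive by [big]. *)
have thE : threshold (size X) k kt eps delta =
    (size X)%:R / k%:R - gamma eps delta.
  apply/max_idPl; rewrite /kt natrM.
  have -> : (size X)%:R / k%:R = 2 * ((size X)%:R / (2 * k%:R)) :> R.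
    by field; rewrite gt_eqF.
  by move: big; rewrite [(2%:R * k%:R)]/(2 * k%:R); lra.
have cy : (size X)%:R / k%:R < c%:R :> R.
  by apply: (lt_le_trans heavy); rewrite ler_nat (ss_lower inv Cy).
rewrite [X in P X](_ : _ = eta y @^-1`
    `](size X)%:R / k%:R - gamma eps delta - c%:R, +oo[)%classic; last first.
  apply/seteqP; split => w;
    rewrite /mkset -fndSome fnd_DPSS -/C Cy thE /= in_itv /= andbT.
    by case: ifP => // H _; rewrite ltrBlDl.
  by case: ifP => //; rewrite -ltrBlDl => ->.
(* Here $e^{-\varepsilon\gamma}=\delta/2\le\delta$. *)
apply: (@le_trans _ _ (1 - expR (- (eps * gamma eps delta)))%:E).
  rewrite lee_fin lerD2l lerN2 /gamma mulVKf ?gt_eqF //.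
  rewrite -lnV ?posrE ?divr_gt0 // lnK ?posrE ?invr_gt0 ?divr_gt0 // invf_div.
  lra.
apply: (laplace_noise_ge noise yC g0) => // u /=.
by rewrite !in_itv /= andbT => /andP[u1 u2]; lra.
Qed.

End Accuracy.

(** * Successors and predecessors in a duplicate-free list *)

Section Chain.
Local Open Scope nat_scope.
Variables (T : eqType) (z : T).
Implicit Types (s : seq T) (w y a : T).

(** The index of a word outside [s] is the size of [s], so such words, like the last one, get the
    default [z]. *)
Definition nx s w := nth z s (index w s).+1.

Fixpoint pv s w :=
  if s is y :: s' then if ohead s' == Some w then y else pv s' w else z.

Lemma nx_cons y s w : nx (y :: s) w = if w == y then head z s else nx s w.
Proof. by rewrite /nx /= eq_sym; case: eqP => _ //; rewrite nth0. Qed.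

Lemma nx_in s w : nx s w != z -> w \in s /\ nx s w \in behead s.
Proof.
rewrite /nx -nth_behead => H.
have lt : index w s < size (behead s).
  by rewrite ltnNge; apply: contra H => le; rewrite nth_default.
split; last exact: mem_nth.
by rewrite -index_mem (leq_trans lt) // size_behead leq_pred.
Qed.

Lemma ohead_neq s w : uniq s -> w \in behead s -> (ohead s == Some w) = false.
Proof.
case: s => //= y s /andP[ys _] ws; apply/eqP => -[E].
by rewrite E ws in ys.
Qed.

Lemma nx_irr s y : uniq s -> y != z -> nx s y != y.
Proof.
move=> + yz; elim: s => [|a s IH] /=; first by rewrite /nx eq_sym.
move=> /andP[as_ us]; rewrite nx_cons; case: (y =P a) => [E|_]; last exact: IH.
case: s as_ {us IH} => [|b s] /=; first by rewrite eq_sym.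
by rewrite inE negb_or eq_sym E => /andP[].
Qed.

Lemma pv_nx s w y : uniq s -> nx s w = y -> y != z -> pv s y = w.
Proof.
elim: s => [|y' s IH] /=; first by move=> _ <-; rewrite /nx eqxx.
move=> /andP[ys us]; rewrite nx_cons; case: eqP => [<- hy yz|_ ny yz].
  case: s hy {IH ys us} => [E|a s /= ->]; last by rewrite eqxx.
  by rewrite -E eqxx in yz.
have [_] : w \in s /\ nx s w \in behead s by apply: nx_in; rewrite ny.
by rewrite ny => /(ohead_neq us) ->; apply: IH.
Qed.

Lemma nx_pv s y : uniq s -> y \in behead s ->
  pv s y \in s /\ nx s (pv s y) = y.
Proof.
elim: s => // y' s IH /= /andP[ys us] yS.
case: eqP => [|ne].
  by case: s yS {IH ys us} => // a s _ [->]; rewrite mem_head nx_cons eqxx.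
have [] := IH us.
  by case: s yS ne {IH ys us} => // a s /=; rewrite inE => /predU1P[-> []|].
move=> ps nps; rewrite inE ps orbT nx_cons; case: eqP => // E.
by rewrite -E ps in ys.
Qed.

Lemma nx_filter s w y : uniq s -> w != y -> y != z ->
  nx [seq a <- s | a != y] w = if nx s w == y then nx s y else nx s w.
Proof.
move=> us wy yz; elim: s us => [|a s IH] /=.
  by rewrite /nx /= eq_sym (negPf yz).
move=> /andP[as_ us]; rewrite !nx_cons; case: eqVneq => [E|ay] /=.
  subst a; have ys := as_.
  have -> : [seq b <- s | b != y] = s.
    by apply/all_filterP/allP => b bs; apply: contraNneq ys => <-.
  rewrite (negPf wy); case: (nx s w =P y) => // nw.
  have [_ /mem_behead] : w \in s /\ nx s w \in behead s.
    by apply: nx_in; rewrite nw.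
  by rewrite nw (negPf ys).
rewrite nx_cons; case: (w =P a) => [_|_]; last exact: IH.
case: s us as_ {IH} => [|b s] /=; first by rewrite eq_sym (negPf yz).
move=> /andP[bs us] _; rewrite nx_cons.
case: eqVneq => [E|//] /=; subst b.
have -> // : [seq c <- s | c != y] = s.
by apply/all_filterP/allP => c cs; apply: contraNneq bs => <-.
Qed.

(** By [pv_nx] it is enough to check the successor of the claimed predecessor, which [nx_filter]
    computes. *)
Lemma pv_filter s a y : uniq s -> a \in behead s -> a != y -> a != z ->
  y != z ->
  y \in behead s -> pv [seq b <- s | b != y] a = if pv s a == y then pv s y else pv s a.
Proof.
move=> us aS ay az yz yS; apply: pv_nx => //; first exact: filter_uniq.
have [py npy] := nx_pv us yS; have [pa npa] := nx_pv us aS.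
have npy_y : pv s y != y.
  by apply: contraNneq (nx_irr us yz) => E; rewrite -{2}npy E.
case: (pv s a =P y) => [E|/eqP pay]; last first.
  by rewrite nx_filter // npa (negPf ay).
by rewrite nx_filter // npy eqxx -E npa.
Qed.

End Chain.
Arguments pv : simpl never.

(** * Doubly linked lists in a total store *)

Section Linked.
Local Open Scope fset_scope.
Local Open Scope nat_scope.
Variable U : choiceType.
Implicit Types (X : seq U) (C : {fmap U -> nat}) (w : word U).
Notation store := (nat -> word U -> word U).
Notation null := (inr 0 : word U).
Implicit Types g : store.

Definition cnt C a := odflt 0 C.[? a].

Definition key C w := match w with inl a => cnt C a | inr c => c end.

(** The sentinel [inr c] gives every item of the bucket a predecessor, so the front of a list needs
    no special treatment. *)
Definition chain X C c : seq (word U) :=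
  inr c :: [seq inl a | a <- bucket X C c].

(* Array 0 holds the counters; arrays 1 and 2 hold the next and the previous
   word in the chain of a counter value, which the value itself, as a word,
   heads. Cell 0 of array 2 is never read and left unspecified. *)
Record linked X C g : Prop := Linked {
  linked_cnt : forall a, g 0 (inl a) = inr (cnt C a);
  linked_nxt : forall w, g 1 w = nx null (chain X C (key C w)) w;
  linked_prv : forall a, g 2 (inl a) = pv null (chain X C (cnt C a)) (inl a);
  linked_cnt_num : forall c, g 0 (inr c) = null;
  linked_prv_num : forall c, 0 < c -> g 2 (inr c) = null;
  linked_other : forall b w, 2 < b -> g b w = null }.

Definition upd g b i w : store :=
  fun b' j => if (b' == b) && (j == i) then w else g b' j.

(** If [y] is last, [q] is null and the write to array 2 lands in its unspecified cell 0. The same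
    happens in [link_store] when the list is empty. *)
Definition unlink_store g y : store :=
  let p := g 2 y in let q := g 1 y in
  upd (upd (upd (upd (upd g 1 p q) 2 q p) 0 y null) 1 y null) 2 y null.

Definition link_store g x c : store :=
  let h := g 1 (inr c) in
  upd (upd (upd (upd (upd g 1 x h) 2 x (inr c)) 1 (inr c) x) 2 h x) 0 x (inr c).

Lemma inl_inj : injective (@inl U nat). Proof. by move=> a b []. Qed.

Lemma uniq_chain X C c : uniq (chain X C c).
Proof.
rewrite /= map_inj_uniq ?uniq_bucket ?andbT; last exact: inl_inj.
by apply/mapP => -[].
Qed.

Lemma inl_chain X C c a :
  (inl a \in chain X C c) = (C.[? a] == Some c) && (a \in X).
Proof. by rewrite inE /= mem_map ?mem_bucket //; exact: inl_inj. Qed.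

Lemma key_chain X C c w : w \in chain X C c -> key C w = c.
Proof.
case: w => [a|c']; first by rewrite inl_chain /= /cnt => /andP[/eqP ->].
by rewrite inE => /predU1P[[]//|/mapP[]].
Qed.

Lemma behead_chain X C c w : w \in behead (chain X C c) -> exists a, w = inl a.
Proof. by move=> /mapP[a _ ->]; exists a. Qed.

Lemma cnt_rem1 C y a : cnt C.[~ y] a = if a == y then 0 else cnt C a.
Proof. by rewrite /cnt fnd_rem1; case: (a == y). Qed.

Lemma key_rem1 C y w : key C.[~ y] w = if w == inl y then 0 else key C w.
Proof. by case: w => [a|c] //=; rewrite cnt_rem1 (inj_eq inl_inj). Qed.

Lemma chain_rem1 X C y c :
  chain X C.[~ y] c = [seq w <- chain X C c | w != inl y].
Proof.
rewrite /= filter_map /bucket -filter_predI /=; congr (_ :: map _ _).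
apply: eq_filter => a /=; rewrite fnd_rem1 (inj_eq inl_inj).
by case: (a == y).
Qed.

(** Untracked items have [cnt] 0; since chain 0 is a bare sentinel, the formulas in [linked] give
    them null pointers. *)
Lemma chain0 X C : (forall a c, C.[? a] = Some c -> 0 < c) ->
  chain X C 0 = [:: null].
Proof.
move=> pC; rewrite /chain (_ : bucket X C 0 = [::]) //.
apply/eqP; rewrite -(negbK (_ == _)) -has_filter; apply/hasPn => a _.
by apply/eqP => /pC.
Qed.

Lemma linked_unlink X C g y c :
  (forall a c, C.[? a] = Some c -> 0 < c) -> {subset domf C <= X} ->
  linked X C g -> C.[? y] = Some c ->
  linked X C.[~ y] (unlink_store g (inl y)).
Proof.
move=> pC sC [cE nE pE c0 p0 oE] Cy.
have cy : cnt C y = c by rewrite /cnt Cy.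
have yX : y \in X by apply: sC; rewrite -fndSome Cy.
have yc : inl y \in behead (chain X C c).
  by rewrite /= mem_map ?mem_bucket ?Cy ?eqxx //; exact: inl_inj.
have [pc np] := nx_pv null (uniq_chain X C c) yc.
set p := pv _ _ _ in pc np; set q := nx null (chain X C c) (inl y).
have gp : g 2 (inl y) = p by rewrite pE cy.
have gq : g 1 (inl y) = q by rewrite nE /= cy.
have qP : q != null -> q \in behead (chain X C c) by move=> /nx_in[].
have pC' a d : C.[~ y].[? a] = Some d -> 0 < d.
  by rewrite fnd_rem1; case: eqP => // _ /pC.
have py : p != inl y.
  apply: contraTneq (nx_irr (uniq_chain X C c) (isT : inl y != null)) => E.
  by rewrite -{2}np E eqxx.
have qy : q != inl y by apply: nx_irr => //; exact: uniq_chain.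
rewrite /unlink_store gp gq; split.
- move=> a; rewrite /upd /= (inj_eq inl_inj) cnt_rem1.
  by case: eqP => // _; rewrite cE.
- move=> w; rewrite /upd /= key_rem1; case: (eqVneq w (inl y)) => [->|wy].
    by rewrite chain0.
  rewrite chain_rem1 nx_filter //; last exact: uniq_chain.
  case: (w =P p) => [->|wp]; first by rewrite (key_chain pc) np eqxx.
  (* A word whose successor is [y] lies in the chain of [c], hence is the predecessor [p]. *)
  rewrite nE; case: (nx _ _ w =P inl y) => // nw.
  have /nx_in[_] : nx null (chain X C (key C w)) w != null by rewrite nw.
  rewrite nw => /mem_behead/key_chain /=; rewrite cy => kw; case: wp.
  by apply/esym/pv_nx => //; [exact: uniq_chain|rewrite kw].
- move=> a; rewrite /upd /= (inj_eq inl_inj) cnt_rem1.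
  case: (eqVneq a y) => [_|ay]; first by rewrite chain0.
  rewrite chain_rem1 pE; case Ca: C.[? a] => [d|]; last first.
    have -> : cnt C a = 0 by rewrite /cnt Ca.
    rewrite chain0 //=; case: eqP => // qa.
    have /qP : q != null by rewrite -qa.
    by rewrite -qa => /mem_behead; rewrite inl_chain Ca.
  have ad : inl a \in behead (chain X C d).
    rewrite /= mem_map; last exact: inl_inj.
    by rewrite mem_bucket Ca eqxx sC // -fndSome Ca.
  have -> : cnt C a = d by rewrite /cnt Ca.
  (* Only the chain of [c] changes, since [y] and [q], if [q] is an item, lie in no other. *)
  case: (eqVneq d c) => [E|dc].
    subst d; rewrite pv_filter //; last exact: uniq_chain.
    have [_ na] := nx_pv null (uniq_chain X C c) ad.
    case: (pv _ _ (inl a) =P inl y) => pa; first by rewrite -na pa eqxx.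
    by case: eqP => // qa; case: pa; apply: pv_nx => //; exact: uniq_chain.
  have -> : (inl a == q) = false.
    apply/eqP => qa; have /qP : q != null by rewrite -qa.
    rewrite -qa => /mem_behead; rewrite inl_chain Ca => /andP[/eqP[E]].
    by rewrite E eqxx in dc.
  congr pv; apply/esym/all_filterP/allP => b bs.
  apply: contraNneq dc => E; move: bs; rewrite E => /key_chain /=.
  by rewrite cy => ->.
- by move=> d; rewrite /upd /= c0.
- move=> d d0; rewrite /upd /=; case: eqP => [qd|_]; last exact: p0.
  have /qP/behead_chain[] : q != null by rewrite -qd; case: (d) d0.
  by rewrite -qd.
by move=> [|[|[|b]]] w //= _; rewrite /upd /= oE.
Qed.

(** [x] becomes the most recent item and so heads its bucket; erasing its old position in [recent]
    changes no bucket, because [x] had no counter. *)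
Lemma bucket_link X C x c d : C.[? x] = None ->
  bucket (rcons X x) C.[x <- c] d =
  (if d == c then [:: x] else [::]) ++ bucket X C d.
Proof.
move=> Cx; rewrite /bucket recent_rcons /= fnd_set eqxx (inj_eq Some_inj) eq_sym.
have -> : [seq a <- [seq y <- recent X | y != x] | C.[x <- c].[? a] == Some d] =
    [seq a <- recent X | C.[? a] == Some d].
  rewrite -filter_predI; apply: eq_filter => a /=; rewrite fnd_set.
  by case: (eqVneq a x) => [->|_] /=; rewrite ?Cx ?andbT ?andbF.
by case: eqP.
Qed.

Lemma linked_link X C g x c :
  (forall a c, C.[? a] = Some c -> 0 < c) ->
  linked X C g -> C.[? x] = None -> 0 < c ->
  linked (rcons X x) C.[x <- c] (link_store g (inl x) c).
Proof.
move=> pC [cE nE pE c0 p0 oE] Cx cgt0.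
set B : seq (word U) := [seq inl a | a <- bucket X C c].
have chc : chain (rcons X x) C.[x <- c] c = [:: inr c, inl x & B].
  by rewrite /chain bucket_link // eqxx.
have chd d : d != c -> chain (rcons X x) C.[x <- c] d = chain X C d.
  by move=> dc; rewrite /chain bucket_link // (negPf dc).
have cntE a : cnt C.[x <- c] a = if a == x then c else cnt C a.
  by rewrite /cnt fnd_set; case: (a == x).
have keyE w : key C.[x <- c] w = if w == inl x then c else key C w.
  by case: w => [a|d] //=; rewrite cntE (inj_eq inl_inj).
have hE : g 1 (inr c) = head null B by rewrite nE /= nx_cons eqxx.
have hP a : (inl a == head null B) = (ohead B == Some (inl a)).
  by rewrite eq_sym; case: (B).
have xB : inl x \notin B.
  by rewrite mem_map ?mem_bucket ?Cx //; exact: inl_inj.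
have hB : head null B != null -> exists2 a, head null B = inl a & C.[? a] = Some c.
  rewrite /B; case Eb: (bucket X C c) => [|a s] //= _; exists a => //.
  have : a \in bucket X C c by rewrite Eb mem_head.
  by rewrite mem_bucket => /andP[/eqP].
rewrite /link_store hE; split.
- by move=> a; rewrite /upd /= (inj_eq inl_inj) cntE; case: eqP.
- move=> w; rewrite /upd /= keyE; case: (eqVneq w (inl x)) => [->|wx].
    by rewrite chc !nx_cons eqxx.
  case: (eqVneq w (inr c)) => [->|wc]; first by rewrite /= chc nx_cons eqxx.
  rewrite nE; case: (eqVneq (key C w) c) => [->|kc]; last by rewrite chd.
  by rewrite chc !nx_cons (negPf wc) (negPf wx).
- move=> a; rewrite /upd /= (inj_eq inl_inj) cntE hP.
  case: (eqVneq a x) => [->|ax].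
    rewrite chc /pv /= eqxx; case: eqP => // hx.
    by have := xB; case: (B) hx => //= w s [->]; rewrite mem_head.
  rewrite pE; case: (eqVneq (cnt C a) c) => [->|kc].
    rewrite chc /chain -/B /pv /= -/(pv null B (inl a)).
    rewrite (inj_eq Some_inj) (inj_eq inl_inj) [x == a]eq_sym (negPf ax).
    by case: ifP => // H; rewrite ?ifF.
  rewrite chd //; case: eqP => // hb.
  have ha : head null B = inl a by case: (B) hb => //= w s [].
  have [a'] : exists2 a, head null B = inl a & C.[? a] = Some c.
    by apply: hB; rewrite ha.
  by rewrite ha => -[<-] Ca; rewrite /cnt Ca eqxx in kc.
- by move=> d; rewrite /upd /= c0.
- move=> d d0; rewrite /upd /=; case: eqP => [hd|_]; last exact: p0.
  have [a] : exists2 a, head null B = inl a & C.[? a] = Some c.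
    by apply: hB; rewrite -hd; case: (d) d0.
  by rewrite -hd.
by move=> [|[|[|b]]] w //= _; rewrite /upd /= oE.
Qed.

End Linked.

(** * Loop-free programs and their running time *)

Section Cost.
Local Open Scope nat_scope.

Definition width := 16.

Fixpoint plain (c : cmd) : bool :=
  match c with
  | Skip => true
  | Op (Const r _) | Op (Move r _) | Op (Add r _ _) | Op (Get r _ _) => r < width
  | Op (Put _ _ _) | Op (Del _ _) => true
  | Op _ => false
  | Seq c1 c2 => plain c1 && plain c2
  | If (Has _ _) _ _ => false
  | If _ c1 c2 => plain c1 && plain c2
  | While _ _ => false
  end.

(** A worst-case step count for [plain] programs; the value at [While] is a mere default. *)
Fixpoint cost (c : cmd) : nat :=
  match c with
  | Skip => 0
  | Op _ => 1
  | Seq c1 c2 => cost c1 + cost c2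
  | If _ c1 c2 => (maxn (cost c1) (cost c2)).+1
  | While _ _ => 0
  end.

End Cost.

(** * Simulation of machine states by total register files and stores *)

Section Simulation.
Local Open Scope fset_scope.
Local Open Scope nat_scope.
Variables (R : realType) (U : choiceType) (eps delta : R) (xi : nat -> R).
Variable N : nat.
Notation word := (word U).
Notation state := (state R U).
Notation null := (inr 0 : word).
Notation regfile := (nat -> word).
Notation store := (nat -> word -> word).
Implicit Types (s : state) (f : regfile) (g : store).

Definition look s b i : word := odflt null (cells s).[? (b, i)].

Definition setr f r w : regfile := fun q => if q == r then w else f q.

Definition bounded s : Prop :=
  [/\ size (regs s) <= width, forall r, num (reg s r) <= N &
      forall p w, (cells s).[? p] = Some w -> num p.2 <= N /\ num w <= N].

(* As no cell holds the null word, [look] determines which cells are occupied. *)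
Record sim s f g : Prop := Sim {
  sim_bounded : bounded s;
  sim_reg : forall r, reg s r = f r;
  sim_look : forall b i, look s b i = g b i;
  sim_full : forall p, (cells s).[? p] <> Some null;
  sim_draws : draws s = 0;
  sim_out : out s = [::] }.

Definition atest (b : test) f : bool :=
  match b with
  | Eq p q => f p == f q
  | Lt p q => num (f p) < num (f q)
  | Has _ _ => false
  end.

(* The cases [False] are those excluded by [plain] or not needed. *)
Fixpoint wp (c : cmd) f g (Q : regfile -> store -> Prop) : Prop :=
  match c with
  | Skip => Q f g
  | Op (Const r n) => n <= N /\ Q (setr f r (inr n)) g
  | Op (Move r q) => Q (setr f r (f q)) g
  | Op (Add r p q) => num (f p) + num (f q) <= N /\
      Q (setr f r (inr (num (f p) + num (f q)))) g
  | Op (Get r b i) => Q (setr f r (g b (f i))) g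
  | Op (Put b i r) => f r <> null /\ Q f (upd g b (f i) (f r))
  | Op (Del b i) => Q f (upd g b (f i) null)
  | Op _ => False
  | Seq c1 c2 => wp c1 f g (fun f' g' => wp c2 f' g' Q)
  | If b c1 c2 => if atest b f then wp c1 f g Q else wp c2 f g Q
  | While _ _ => False
  end.

Lemma reg_set_reg s r w q : reg (set_reg s r w) q = setr (reg s) r w q.
Proof. by rewrite /reg /= nth_set_nth. Qed.

Lemma bounded_set_reg s r w :
  bounded s -> r < width -> num w <= N -> bounded (set_reg s r w).
Proof.
move=> [sz br bc] rw wN; split=> //.
  by rewrite /= size_set_nth geq_max rw.
by move=> q; rewrite reg_set_reg /setr; case: eqP.
Qed.

Lemma sim_set_reg s f g r w : sim s f g -> r < width -> num w <= N ->
  sim (set_reg s r w) (setr f r w) g.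
Proof.
move=> [bs rs ls fs ds os] rw wN; split=> //; first exact: bounded_set_reg.
by move=> q; rewrite reg_set_reg /setr rs.
Qed.

Lemma sim_num s f g r : sim s f g -> num (f r) <= N.
Proof. by case=> [[_ br _] <- _ _ _]. Qed.

Lemma sim_look_num s f g b i : sim s f g -> num (g b i) <= N.
Proof.
case=> [[_ _ bc] _ <- _ _ _]; rewrite /look.
by case E: (cells s).[? _] => [w|] //=; have [] := bc _ _ E.
Qed.

Lemma upd_pair g b i w b' i' :
  upd g b i w b' i' = if (b', i') == (b, i) then w else g b' i'.
Proof. by rewrite /upd xpair_eqE. Qed.

Lemma sim_put s f g b i w : sim s f g -> num i <= N -> num w <= N -> w <> null ->
  sim (set_cells s (cells s).[(b, i) <- w]) f (upd g b i w).
Proof.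
move=> [[sz br bc] rs ls fs ds os] iN wN w0; split=> //.
- split=> // p v; rewrite /= fnd_set; case: eqP => [-> [<-]//|_]; exact: bc.
- move=> b' i'; rewrite upd_pair /look /= fnd_set -ls.
  by case: ((b', i') == (b, i)).
- by move=> p; rewrite /= fnd_set; case: eqP => // _ [].
Qed.

Lemma sim_del s f g b i : sim s f g ->
  sim (set_cells s (cells s).[~ (b, i)]) f (upd g b i null).
Proof.
move=> [[sz br bc] rs ls fs ds os]; split=> //.
- split=> // p v; rewrite /= fnd_rem1; case: eqP => //= _; exact: bc.
- move=> b' i'; rewrite upd_pair /look /= fnd_rem1 -ls.
  by case: ((b', i') == (b, i)).
- by move=> p; rewrite /= fnd_rem1; case: eqP => //= _; exact: fs.
Qed.

Lemma sim_op o s f g Q : plain (Op o) -> sim s f g -> wp (Op o) f g Q ->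
  exists f' g', sim (op_eval eps delta xi o s) f' g' /\ Q f' g'.
Proof.
move=> pl ss; have sn r := sim_num r ss; have sr := sim_reg ss.
case: o pl => //= [r n|r q|r p q|r b i|b i r|b i] rw.
- by move=> [nN HQ]; do 2 eexists; split; last exact: HQ; exact: sim_set_reg.
- move=> HQ; do 2 eexists; split; last exact: HQ.
  by rewrite sr; apply: sim_set_reg.
- move=> [nN HQ]; do 2 eexists; split; last exact: HQ.
  by rewrite !sr; apply: sim_set_reg.
- move=> HQ; do 2 eexists; split; last exact: HQ.
  rewrite -/(look s b _) sr (sim_look ss); apply: sim_set_reg => //.
  exact: sim_look_num ss.
- move=> [r0 HQ]; do 2 eexists; split; last exact: HQ.
  by rewrite !sr; apply: sim_put.
- move=> HQ; do 2 eexists; split; last exact: HQ.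
  by rewrite !sr; apply: sim_del.
Qed.

(** Soundness of [wp]. The bounds are carried through every intermediate state because memory is
    limited at all times. *)
Lemma wp_exec c s f g Q : plain c -> sim s f g -> wp c f g Q ->
  exists tr f' g', [/\ exec eps delta xi c s tr, size tr <= cost c,
    all (fun s' => `[< bounded s' >]) tr, sim (last s tr) f' g' & Q f' g'].
Proof.
elim: c s f g Q => [|o|c1 IH1 c2 IH2|b c1 IH1 c2 IH2|b c IH] s f g Q //=.
- by move=> _ ss HQ; exists [::], f, g; split=> //; constructor.
- move=> pl ss HQ; have [f' [g' [ss' HQ']]] := sim_op pl ss HQ.
  exists [:: op_eval eps delta xi o s], f', g'; split=> //; first by constructor.
  by rewrite /= andbT; apply/asboolP; case: ss'.
- move=> /andP[p1 p2] ss /(IH1 _ _ _ _ p1 ss)[t1 [f1 [g1 [e1 z1 b1 ss1]]]].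
  move=> /(IH2 _ _ _ _ p2 ss1)[t2 [f2 [g2 [e2 z2 b2 ss2 HQ]]]].
  exists (t1 ++ t2), f2, g2; split; rewrite ?last_cat ?all_cat ?b1 //.
    exact: exec_seq e1 e2.
  by rewrite size_cat leq_add.
- move=> pl ss HQ.
  have [p1 p2] : plain c1 /\ plain c2 by apply/andP; case: (b) pl.
  have bE : test_eval b s = atest b f.
    by case: (b) pl => //= p q _; rewrite !(sim_reg ss).
  have : exists tr f' g', [/\
      exec eps delta xi (if test_eval b s then c1 else c2) s tr,
      size tr <= maxn (cost c1) (cost c2),
      all (fun s' => `[< bounded s' >]) tr, sim (last s tr) f' g' & Q f' g'].
    rewrite bE; move: HQ; case: atest => HQ.
      have [t [f' [g' [? ? ? ? ?]]]] := IH1 _ _ _ _ p1 ss HQ.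
      by exists t, f', g'; split; rewrite ?leq_max ?(leqW) //; apply/orP; left.
    have [t [f' [g' [? ? ? ? ?]]]] := IH2 _ _ _ _ p2 ss HQ.
    by exists t, f', g'; split; rewrite ?leq_max //; apply/orP; right.
  move=> [t [f' [g' [et zt bt st HQ']]]]; exists (s :: t), f', g'; split=> //.
    exact: exec_if.
  by rewrite /= bt andbT; apply/asboolP; case: ss.
Qed.

(** A step creates at most one cell. This controls memory in the middle of an update, where the
    store need not be [linked]. *)
Lemma exec_cells c s tr : exec eps delta xi c s tr ->
  all (fun s' => #|` domf (cells s')| <= #|` domf (cells s)| + size tr) (s :: tr).
Proof.
suff H : exec eps delta xi c s tr -> forall n, #|` domf (cells s)| <= n ->
    all (fun s' => #|` domf (cells s')| <= n + size tr) (s :: tr).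
  by move=> e; apply: H.
elim=> {c s tr} [s|o s|c1 c2 s t1 t2 _ IH1 _ IH2|b c1 c2 s t _ IH|b c s _|
  b c s t1 t2 _ _ IH1 _ IH2] n sn /=.
- by rewrite addn0 sn.
- rewrite andbT addn1 leqW //=.
  case: o => [r m|r q|r p q|r p q|r b i|b i r|b i|r v th] /=; rewrite ?(leqW sn) //.
    by rewrite cardfsU1 -add1n leq_add // leq_b1.
  by rewrite (leq_trans (fsubset_leq_card (fset_sub _ _))) // leqW.
- have := IH1 n sn; rewrite size_cat all_cat => /= /andP[_ a1].
  have sl : #|` domf (cells (last s t1))| <= n + size t1.
    case/lastP: t1 a1 {IH1 IH2} => [|t1 s1]; first by rewrite addn0.
    by rewrite all_rcons last_rcons => /andP[].
  have /andP[_] := IH2 _ sl => a2.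
  rewrite !(leq_trans sn (leq_addr _ _)) /=; apply/andP; split.
    by apply: sub_all a1 => s' H; apply: leq_trans H _; lia.
  by apply: sub_all a2 => s' H; apply: leq_trans H _; lia.
- have /andP[_] := IH n sn; rewrite addnS !(leqW (leq_trans sn (leq_addr _ _))) //=.
  by apply: sub_all => s' H; rewrite leqW.
- by rewrite addn1 leqW.
- have := IH1 n sn; rewrite size_cat all_cat => /= /andP[_ a1].
  have sl : #|` domf (cells (last s t1))| <= n + size t1.
    case/lastP: t1 a1 {IH1 IH2} => [|t1 s1]; first by rewrite addn0.
    by rewrite all_rcons last_rcons => /andP[].
  have /andP[_] := IH2 _ sl => a2.
  rewrite !(leq_trans sn (leq_addr _ _)) /=; apply/andP; split.
    by apply: sub_all a1 => s' H; apply: leq_trans H _; lia.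
  by apply: sub_all a2 => s' H; apply: leq_trans H _; lia.
Qed.

End Simulation.

(** * The update program *)

Definition block (cs : seq cmd) : cmd := foldr Seq Skip cs.

(** Storing null frees the cell: null pointers cost no memory and [sim_full] is maintained. *)
Definition put_or_del b i r := If (Eq r 6) (Op (Del b i)) (Op (Put b i r)).

Definition unlink : cmd := block
  [:: Op (Get 11 2 9); Op (Get 12 1 9); put_or_del 1 11 12; put_or_del 2 12 11;
      Op (Del 0 9); Op (Del 1 9); Op (Del 2 9)].

Definition link : cmd := block
  [:: Op (Get 11 1 10); put_or_del 1 2 11; Op (Put 2 2 10); Op (Put 1 10 2);
      Op (Put 2 11 2); Op (Put 0 2 10)].

(* Registers: 0 is [k], 1 is [kt], 2 is the stream item, 3 is the length of the
   stream, 4 is the number of tracked items, 5 is the least counter, 6 is zero,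
   7 is one, 8 is the old counter of the item that leaves its list, 9 is this
   item, 10 is the new counter of item 2; 11 and 12 hold list neighbours. *)
Definition place : cmd := block
  [:: Op (Add 10 8 7);
      If (Eq 8 5)
         (Seq (Op (Get 11 1 8)) (If (Eq 11 6) (Op (Move 5 10)) Skip)) Skip;
      link].

(** An empty counter cell reads as 0, which signals an untracked item. For an item entering a table
    with room, registers 5 and 8 are both 0; list 0 is empty, so [place] raises the least counter to
    1. *)
Definition update : cmd := block
  [:: Op (Const 7 1); Op (Add 3 3 7); Op (Get 8 0 2);
      If (Eq 8 6)
         (If (Lt 4 1)
             (Seq (Op (Add 4 4 7)) (Op (Const 5 0)))
             (block [:: Op (Move 8 5); Op (Get 9 1 5); unlink]))
         (Seq (Op (Move 9 2)) unlink);
      place].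

(** * Correctness of one update *)

Section Update.
Local Open Scope fset_scope.
Local Open Scope nat_scope.
Variable U : choiceType.
Variable N : nat.
Notation word := (word U).
Notation null := (inr 0 : word).
Notation regfile := (nat -> word).
Notation store := (nat -> word -> word).
Implicit Types (X : seq U) (C : {fmap U -> nat}) (f : regfile) (g : store).
Implicit Types (Q : regfile -> store -> Prop).

Lemma wp_put_or_del b i r f g Q : f 6 = null ->
  Q f (upd g b (f i) (f r)) -> wp N (put_or_del b i r) f g Q.
Proof. by move=> f6 HQ /=; rewrite f6; case: eqP HQ => [->|]. Qed.

#[local] Opaque put_or_del.

Lemma wp_unlink f g Q : f 6 = null ->
  Q (setr (setr f 11 (g 2 (f 9))) 12 (g 1 (f 9))) (unlink_store g (f 9)) ->
  wp N unlink f g Q.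
Proof.
move=> f6 HQ; rewrite /unlink /block /foldr.
rewrite /=.
by do 2 (apply: wp_put_or_del => //).
Qed.

Lemma wp_link f g Q x c : f 6 = null -> f 10 = inr c -> f 2 = inl x -> 0 < c ->
  Q (setr f 11 (g 1 (f 10))) (link_store g (inl x) c) -> wp N link f g Q.
Proof.
move=> f6 f10 f2 c0 HQ; rewrite /link /block /foldr /=.
have c0' : inr c <> null by case: (c) c0.
apply: wp_put_or_del => //=; rewrite /setr /= f2 f10; do 4 split=> //.
by rewrite f10 in HQ; exact: HQ.
Qed.

(** The minimum is required to be attained only if the table is nonempty; any [m] is accepted for
    the empty table. *)
Definition least C m :=
  (forall a b, C.[? a] = Some b -> m <= b) /\
  (forall a b, C.[? a] = Some b -> exists a', C.[? a'] = Some m).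

#[local] Opaque unlink link.

(** [C] is the table after a possible removal, [c] the counter given up and [m] the content of
    register 5. The value [m] can lack a holder only if [c = m]. *)
Lemma wp_place X C c m x f g Q :
  f 6 = null -> f 7 = inr 1 -> f 8 = inr c -> f 5 = inr m -> f 2 = inl x ->
  c < N -> linked X C g -> (forall a b, C.[? a] = Some b -> 0 < b) ->
  {subset domf C <= X} -> C.[? x] = None ->
  (forall a b, C.[? a] = Some b -> m <= b) -> m <= c ->
  c = m \/ (exists a, C.[? a] = Some m) ->
  (forall f' g' m', {in [:: 0; 1; 3; 4; 6], f' =1 f} -> f' 5 = inr m' ->
     least C.[x <- c.+1] m' -> linked (rcons X x) C.[x <- c.+1] g' -> Q f' g') ->
  wp N place f g Q.
Proof.
move=> f6 f7 f8 f5 f2 cN L pC sC Cx mC mc cm HQ.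
have last_ f' m' : {in [:: 0; 1; 3; 4; 6], f' =1 f} -> f' 2 = inl x ->
    f' 10 = inr c.+1 -> f' 5 = inr m' -> least C.[x <- c.+1] m' ->
    wp N link f' g Q.
  move=> ff f'2 f'10 f'5 lm; apply: (wp_link _ f'10 f'2) => //.
    by rewrite ff.
  apply: (HQ _ _ m') => //; last exact: linked_link.
  by move=> r; rewrite !inE => /or4P[|||/orP[]] /eqP ->; rewrite /setr /= ff.
rewrite /place /block /foldr /= /setr /= f8 f7 f5 addn1; split=> //.
have ff w w' : {in [:: 0; 1; 3; 4; 6],
    (fun q => if q == 11 then w else if q == 10 then w' else f q) =1 f}.
  by move=> r; rewrite !inE => /or4P[|||/orP[]] /eqP ->.
have keep : (exists a, C.[? a] = Some m) -> least C.[x <- c.+1] m.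
  move=> [a Ca]; split=> [a' b|_ _ _].
    by rewrite fnd_set; case: eqP => [_ [<-]|_ /mC//]; apply: leqW.
  exists a; rewrite fnd_set; case: eqP => // E.
  by rewrite -E Ca in Cx.
case: eqP => [[E]|ne]; last first.
  apply: (last_ _ m) => //=; first by move=> r; rewrite !inE => /or4P[|||/orP[]] /eqP ->.
  by apply: keep; case: cm ne => [->|].
rewrite f6 (linked_nxt L) /= nx_cons eqxx.
case Eb: (bucket X C c) => [|a s] /=.
  (* The list of the least counter is empty: all other counters exceed [m], and [x] attains
     [m + 1]. *)
  apply: (last_ _ c.+1) => //.
    by move=> r; rewrite !inE => /or4P[|||/orP[]] /eqP ->.
  split=> [a b|_ _ _]; last by exists x; rewrite fnd_set eqxx.
  rewrite fnd_set; case: eqP => [_ [<-]//|_ Ca].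
  rewrite ltn_neqAle {2}E (mC _ _ Ca) andbT.
  apply/eqP => mb; have : a \in bucket X C c.
    by rewrite mem_bucket Ca mb eqxx sC // -fndSome Ca.
  by rewrite Eb.
apply: (last_ _ m) => //; apply: keep; exists a.
have : a \in bucket X C c by rewrite Eb mem_head.
by rewrite mem_bucket E => /andP[/eqP].
Qed.

Record encodes k kt X f g : Prop := Encodes {
  enc_k : f 0 = inr k;
  enc_kt : f 1 = inr kt;
  enc_size : f 3 = inr (size X);
  enc_card : f 4 = inr #|` domf (SS X kt)|;
  enc_least : exists2 m, f 5 = inr m & least (SS X kt) m;
  enc_zero : f 6 = null;
  enc_linked : linked X (SS X kt) g }.

#[local] Opaque place.

Lemma pos_rem1 C y : (forall a b, C.[? a] = Some b -> 0 < b) ->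
  forall a b, C.[~ y].[? a] = Some b -> 0 < b.
Proof. by move=> pC a b; rewrite fnd_rem1; case: eqP => // _ /pC. Qed.

Lemma sub_rem1 X C y : {subset domf C <= X} -> {subset domf C.[~ y] <= X}.
Proof. by move=> sC a; rewrite domf_rem1 in_fsetD1 => /andP[_ /sC]. Qed.

Lemma wp_update k kt X x f g : 0 < kt -> kt <= N -> size X < N ->
  encodes k kt X f g -> f 2 = inl x ->
  wp N update f g (encodes k kt (rcons X x)).
Proof.
move=> kt0 ktN XN [f0 f1 f3 f4 [m f5 [mC lC]] f6 L] f2.
have inv := ss_invP X kt0; have pC := ss_pos inv; have sC := ss_sub inv.
set C := SS X kt in f4 mC lC L inv pC sC.
have cN a c : C.[? a] = Some c -> c < N.
  by move/fnd_le_sum; rewrite (ss_sum inv) => /leq_ltn_trans; apply.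
rewrite /update /block /foldr /= /setr /= f3 f2 f1 f4 f6 (linked_cnt L) addn1.
split; first exact: leq_ltn_trans XN.
split=> //.
have fin f' g' m' c : f' 0 = inr k -> f' 1 = inr kt -> f' 3 = inr (size X).+1 ->
    f' 4 = inr #|` domf (ss_step kt X C x)| -> f' 6 = null -> f' 5 = inr m' ->
    least (ss_step kt X C x) m' ->
    linked (rcons X x) (ss_step kt X C x) g' -> encodes k kt (rcons X x) f' g'.
  by split; rewrite ?SS_rcons ?size_rcons //; exists m'.
case: (ss_stepP x kt0 (ss_card inv) sC) fin => [c Cx|Cx Cm|y c s Cx Cm By H] fin.
- have -> : cnt C x = c by rewrite /cnt Cx.
  have /negPf -> : inr c != null by rewrite -lt0n; exact: pC Cx.
  apply: wp_unlink => //=.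
  apply: (@wp_place X C.[~ x] c m x) => //=; first exact: cN Cx.
  + exact: linked_unlink Cx.
  + exact: pos_rem1.
  + exact: sub_rem1.
  + by rewrite fnd_rem1 eqxx.
  + by move=> a b; rewrite fnd_rem1; case: eqP => // _ /mC.
  + exact: mC Cx.
  + have [a Ca] := lC _ _ Cx; case: (eqVneq a x) => [E|ax].
      by left; move: Ca; rewrite E Cx => -[].
    by right; exists a; rewrite fnd_rem1 ax.
  move=> f' g' m' ff; apply: fin => //; rewrite ?ff //=.
  by rewrite (card_set_rem1 _ Cx) // fnd_rem1 eqxx.
- have -> : cnt C x = 0 by rewrite /cnt Cx.
  rewrite eqxx Cm.
  rewrite addn1; split; first exact: leq_trans ktN.
  split=> //.
  (* Register 5 was reset to 0, so the old least counter is forgotten and 1 becomes the least. *)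
  apply: (@wp_place X C 0 0 x) => //=.
  + exact: leq_ltn_trans XN.
  + by left.
  move=> f' g' m' ff; apply: fin => //; rewrite ?ff //=.
  by rewrite cardfsU1 -fndSome Cx.
have yC : y \in bucket X C c by rewrite By mem_head.
have [Cy yX] : C.[? y] = Some c /\ y \in X.
  by move: yC; rewrite mem_bucket => /andP[/eqP].
(* Both are the least counter: [least] supplies a holder of [m], and [c] is minimal. *)
have E : c = m.
  have [a Ca] := lC _ _ Cy; apply/eqP; rewrite eqn_leq (mC _ _ Cy).
  by rewrite (H _ _ Ca).
subst c.
have -> : cnt C x = 0 by rewrite /cnt Cx.
rewrite eqxx Cm ltnn.
have gy : g 1 (inr m) = inl y.
  by rewrite (linked_nxt L) /= nx_cons eqxx By.
have xy : C.[~ y].[? x] = None by rewrite fnd_rem1 Cx; case: eqP.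
apply: wp_unlink => //=; rewrite f5 gy.
apply: (@wp_place X C.[~ y] m m x) => //=; first exact: cN Cy.
- exact: linked_unlink Cy.
- exact: pos_rem1.
- exact: sub_rem1.
- by move=> a b; rewrite fnd_rem1; case: eqP => // _ /mC.
- by left.
move=> f' g' m' ff; apply: fin => //; rewrite ?ff //=.
by rewrite (card_set_rem1 _ Cy) // Cm.
Qed.

End Update.

(** * Space and time over the whole stream *)

Section Process.
Local Open Scope fset_scope.
Local Open Scope nat_scope.
Variables (R : realType) (U : choiceType) (eps delta : R) (xi : nat -> R).
Variable N : nat.
Notation word := (word U).
Notation state := (state R U).
Notation null := (inr 0 : word).
Implicit Types (X : seq U) (C : {fmap U -> nat}) (s : state).

(** Each tracked item accounts for four possible addresses: its counter, its two pointers and the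
    sentinel of its counter value. The extra one is cell 0 of array 2. *)
Lemma card_cells X C s f g : sim N s f g ->
  (forall a c, C.[? a] = Some c -> 0 < c) -> linked X C g ->
  #|` domf (cells s)| <= 4 * #|` domf C| + 1.
Proof.
move=> ss pC L.
pose keys : seq (nat * word) := (2, null) ::
  [seq (0, inl a) | a <- domf C] ++ [seq (1, inl a) | a <- domf C] ++
  [seq (2, inl a) | a <- domf C] ++ [seq (1, inr (cnt C a)) | a <- domf C].
have <- : size keys = 4 * #|` domf C| + 1.
  rewrite /= !size_cat !size_map; lia.
apply: uniq_leq_size; first exact: fset_uniq.
move=> [b w]; rewrite -fndSome.
case E: (cells s).[? _] => [v|//] _.
have : g b w != null.
  rewrite -(sim_look ss) /look E /=; apply: contra_notN (sim_full ss (p := (b, w))).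
  by move=> /eqP <-.
have untr a : a \notin domf C -> cnt C a = 0.
  by rewrite -fndSome /cnt; case: C.[? a].
have inK a : a \in domf C -> [/\ (0, inl a) \in keys, (1, inl a) \in keys,
    (2, inl a) \in keys & (1, inr (cnt C a)) \in keys].
  move=> aC; pose h b c : nat * word := (b, c).
  have H0 := map_f (fun a => h 0 (inl a)) aC.
  have H1 := map_f (fun a => h 1 (inl a)) aC.
  have H2 := map_f (fun a => h 2 (inl a)) aC.
  have H3 := map_f (fun a => h 1 (inr (cnt C a))) aC.
  by rewrite /keys !in_cons !mem_cat H0 H1 H2 H3 !orbT.
case: b E => [|[|[|b]]] _.
- case: w => [a|c]; last by rewrite (linked_cnt_num L) eqxx.
  rewrite (linked_cnt L) => ca.
  have /inK[] // : a \in domf C by apply: contraR ca => /untr ->.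
- rewrite (linked_nxt L); case: w => [a|c].
    move=> ca; have /inK[] // : a \in domf C.
    apply: contraR ca => /untr; rewrite /= => ->.
    by rewrite chain0 // nx_cons.
  rewrite /= nx_cons eqxx; case Eb: (bucket X C c) => [//|a t] _.
  have : a \in bucket X C c by rewrite Eb mem_head.
  rewrite mem_bucket => /andP[/eqP Ca _].
  have /inK[_ _ _] : a \in domf C by rewrite -fndSome Ca.
  by rewrite /cnt Ca.
- case: w => [a|[|c]]; last by rewrite (linked_prv_num L).
    rewrite (linked_prv L) => ca; have /inK[] // : a \in domf C.
    by apply: contraR ca => /untr ->; rewrite chain0.
  by rewrite /keys mem_head.
by rewrite (linked_other L).
Qed.

Lemma sim_init k kt : k <= N -> kt <= N ->
  sim N (init R U k kt) (reg (init R U k kt)) (fun _ _ => null).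
Proof.
move=> kN ktN; split=> //.
- split=> //; first by case=> [|[|r]]; rewrite /reg //= nth_nil.
  by move=> p w; rewrite fnd_fmap0.
- by move=> b i; rewrite /look fnd_fmap0.
- by move=> p; rewrite fnd_fmap0.
Qed.

Lemma encodes_init k kt :
  encodes k kt [::] (reg (init R U k kt)) (fun _ _ => null).
Proof.
split=> //.
  by exists 0 => //; split=> a b; rewrite fnd_fmap0.
split=> // [a|w].
  by rewrite /cnt fnd_fmap0.
by rewrite /chain /= nx_cons /nx /= if_same.
Qed.

Lemma process_update k kt X Y s f g :
  0 < kt -> kt <= N -> size X + size Y <= N ->
  sim N s f g -> encodes k kt X f g ->
  exists trs s' f' g', [/\ process eps delta xi update s Y trs s',
    all (fun u => size u <= (cost update).+1) trs,
    all (fun s' => `[< bounded N s' /\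
       #|` domf (cells s')| <= 4 * kt + 1 + cost update >]) (flatten trs),
    sim N s' f' g' & encodes k kt (X ++ Y) f' g'].
Proof.
move=> kt0 ktN; elim: Y X s f g => [|x Y IH] X s f g.
  move=> _ ss es; exists [::], s, f, g; split=> //; first by constructor.
  by rewrite cats0.
rewrite /= addnS => XN ss es.
have XN' : size X < N by apply: leq_trans XN; rewrite ltnS leq_addr.
have si : sim N (input x s) (setr f 2 (inl x)) g by apply: sim_set_reg.
have ei : encodes k kt X (setr f 2 (inl x)) g by case: es.
have := wp_exec eps delta xi (c := update) isT si (wp_update kt0 ktN XN' ei erefl).
move=> [tr [f1 [g1 [etr ztr btr s1 e1]]]].
have [] := IH (rcons X x) _ f1 g1 _ s1 e1; first by rewrite size_rcons.
move=> trs [s' [f' [g' [p z b ss' es']]]].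
exists ((input x s :: tr) :: trs), s', f', g'; split=> //.
- exact: process_cons etr p.
- by rewrite /= ltnS ztr.
- rewrite (_ : flatten _ = (input x s :: tr) ++ flatten trs) // all_cat.
  apply/andP; split=> //.
  have inv := ss_invP X kt0.
  have cs := card_cells si (ss_pos inv) (enc_linked ei).
  have {}cs : #|` domf (cells (input x s))| <= 4 * kt + 1.
    by apply: leq_trans cs _; rewrite leq_add2r leq_mul2l (ss_card inv) orbT.
  have bi : bounded N (input x s) by case: si.
  have ball : all (fun s' => `[< bounded N s' >]) (input x s :: tr).
    by rewrite /= btr andbT; apply/asboolP.
  (* Starting from at most [4 * kt + 1] cells, the update adds at most one per step. *)
  have call := exec_cells etr.
  have := conj ball call => /andP; rewrite -all_predI.
  apply: sub_all => s2 /andP[/asboolP b2 c2]; apply/asboolP; split=> //.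
  by apply: leq_trans c2 _; rewrite leq_add.
by rewrite -cat_rcons.
Qed.


End Process.

(** * The report program *)

Definition gamma_exp : rexp :=
  RMul (RDiv (RConst 1) REps) (RLn (RDiv (RConst 2) RDelta)).

Definition threshold_exp : rexp :=
  RMax (RSub (RDiv (RReg 3) (RReg 0)) gamma_exp)
       (RAdd (RAdd (RDiv (RReg 3) (RReg 1)) (RConst 1)) gamma_exp).

(** Array 0 has a cell for each tracked item and none for null, so the walk stops exactly at the end
    of the list. *)
Definition report_bucket : cmd :=
  While (Has 0 9)
    (Seq (Op (Release 9 (RReg 8) threshold_exp)) (Op (Get 9 1 9))).

Definition report : cmd :=
  Seq (Op (Const 8 0)) (Seq (Op (Const 7 1))
    (While (Lt 8 3) (Seq (Op (Add 8 8 7)) (Seq (Op (Get 9 1 8)) report_bucket)))).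

(** * The order in which the report visits the table *)

Section Enumeration.
Local Open Scope fset_scope.
Local Open Scope nat_scope.
Variable U : choiceType.
Implicit Types (X : seq U) (C : {fmap U -> nat}).

Definition entries X C c := [seq (a, c) | a <- bucket X C c].

Definition enumeration X C (cs : seq nat) := flatten [seq entries X C c | c <- cs].

Lemma mem_enumeration X C cs a c :
  ((a, c) \in enumeration X C cs) = [&& C.[? a] == Some c, a \in X & c \in cs].
Proof.
apply/flatten_mapP/and3P => [[d dcs /mapP[b]]|[Ca aX ccs]].
  by rewrite mem_bucket => /andP[Cb bX] [-> ->].
by exists c => //; apply: map_f; rewrite mem_bucket Ca.
Qed.

Lemma uniq_enumeration X C cs : uniq cs -> uniq (unzip1 (enumeration X C cs)).
Proof.
rewrite /enumeration; elim: cs => //= c cs IH /andP[ccs ucs].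
rewrite /unzip1 map_cat cat_uniq IH // andbT -map_comp map_id uniq_bucket /=.
apply/hasPn => a /mapP[[b d]]; rewrite mem_enumeration => /and3P[/eqP Cb _ dcs] -> /=.
by rewrite mem_bucket Cb; apply/negP => /andP[/eqP[E] _]; rewrite -E dcs in ccs.
Qed.

End Enumeration.

(** * Correctness of the report *)

Section Report.
Local Open Scope fset_scope.
Local Open Scope nat_scope.
Variables (R : realType) (U : choiceType) (eps delta : R) (xi : nat -> R).
Variable N : nat.
Notation word := (word U).
Notation state := (state R U).
Notation null := (inr 0 : word).
Implicit Types (X : seq U) (C : {fmap U -> nat}) (s : state).
Implicit Types (P : pred state) (Q : state -> Prop).

(** A counterpart of [wp] for the report, whose loops and releases [wp] excludes. *)
Definition runs P c s Q := exists tr,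
  [/\ exec eps delta xi c s tr, all P tr & Q (last s tr)].

Lemma runs_op P o s Q : P (op_eval eps delta xi o s) ->
  Q (op_eval eps delta xi o s) -> runs P (Op o) s Q.
Proof.
move=> Ps Qs; exists [:: op_eval eps delta xi o s].
by split=> //=; [constructor|rewrite Ps].
Qed.

Lemma runs_seq P c1 c2 s Q :
  runs P c1 s (fun s' => runs P c2 s' Q) -> runs P (Seq c1 c2) s Q.
Proof.
move=> [t1 [e1 a1 [t2 [e2 a2 q]]]]; exists (t1 ++ t2).
by rewrite all_cat a1 last_cat; split=> //; exact: exec_seq e1 e2.
Qed.

Lemma runs_while_false P b c s Q :
  ~~ test_eval b s -> P s -> Q s -> runs P (While b c) s Q.
Proof.
move=> bs Ps Qs; exists [:: s]; split=> //=; last by rewrite Ps.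
exact: exec_while_false.
Qed.

Lemma runs_while_true P b c s Q : test_eval b s -> P s ->
  runs P c s (fun s' => runs P (While b c) s' Q) -> runs P (While b c) s Q.
Proof.
move=> bs Ps [t1 [e1 a1 [t2 [e2 a2 q]]]]; exists (s :: t1 ++ t2).
rewrite /= Ps all_cat a1 last_cat; split=> //.
exact: exec_while_true e1 e2.
Qed.

(** The draw index advances even when a value is withheld, so the draw assigned to an item does not
    depend on the noise. *)
Fixpoint emitted (th : R) d (es : seq (U * nat)) : seq (U * R) :=
  if es is (a, c) :: es' then
    let v := (c%:R + xi d)%R in
    (if (th < v)%R then [:: (a, v)] else [::]) ++ emitted th d.+1 es'
  else [::].

Lemma emitted_cat th d es es' : emitted th d (es ++ es') =
  emitted th d es ++ emitted th (d + size es) es'.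
Proof.
elim: es d => [|[a c] es IH] d /=; first by rewrite addn0.
by rewrite IH catA addSnnS.
Qed.

Lemma unzip1_emitted th d es : subseq (unzip1 (emitted th d es)) (unzip1 es).
Proof.
elim: es d => // -[a c] es IH d; rewrite /=; case: ifP => _ /=; first by rewrite eqxx.
exact: subseq_trans (IH _) (subseq_cons _ _).
Qed.

Lemma mem_emitted th d es x v : uniq (unzip1 es) ->
  (x, v) \in emitted th d es <-> exists c,
    [/\ (x, c) \in es, v = (c%:R + xi (d + index x (unzip1 es)))%R & (th < v)%R].
Proof.
elim: es d => [|[a c] es IH] d /=; first by split=> // -[c []].
move=> /andP[aes ues]; rewrite mem_cat.
have aE e : (a, e) \notin es.
  by apply: contra aes => H; apply/mapP; exists (a, e).
have aO : (a, v) \notin emitted th d.+1 es.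
  apply: contra aes => H; apply: (mem_subseq (unzip1_emitted th d.+1 es)).
  by apply/mapP; exists (a, v).
have split_ : (x, v) \in (if (th < c%:R + xi d)%R then [:: (a, (c%:R + xi d)%R)] else [::])
   <-> [/\ x = a, v = (c%:R + xi d)%R & (th < v)%R].
  case: ifP => H; last by split=> // -[_ ->]; rewrite H.
  rewrite inE; split=> [/eqP[-> ->]//|[-> -> _]]; exact: eqxx.
case: (eqVneq a x) => [E|ax].
  subst x; rewrite addn0 (negPf aO) orbF split_; split.
    by move=> [_ -> H]; exists c; rewrite mem_head.
  by move=> [e]; rewrite inE (negPf (aE e)) orbF => -[/eqP[->]].
split.
  case/orP => [/split_[E]|/(IH _ ues)[e [H vE thv]]].
    by rewrite E eqxx in ax.
  by exists e; rewrite inE H orbT -addSnnS.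
move=> [e [+ vE thv]]; rewrite inE => /orP[/eqP[E]|H].
  by rewrite E eqxx in ax.
by apply/orP; right; apply/(IH _ ues); exists e; rewrite addSnnS.
Qed.

Variables (k kt : nat) (X : seq U) (M : {fmap nat * word -> word}).
Variable g : nat -> word -> word.
Notation C := (SS X kt).
Hypothesis kt_gt0 : 0 < kt.
Hypothesis XN : size X <= N.
Hypothesis L : linked X C g.
Notation th := (threshold (size X) k kt eps delta).

Definition frozen s := `[< bounded N s /\ cells s = M >].

Record reporting c d o s : Prop := Reporting {
  rep_frozen : bounded N s /\ cells s = M;
  rep_look : forall b i, look s b i = g b i;
  rep_full : forall p, (cells s).[? p] <> Some null;
  rep_k : reg s 0 = inr k;
  rep_kt : reg s 1 = inr kt;
  rep_size : reg s 3 = inr (size X);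
  rep_one : reg s 7 = inr 1;
  rep_count : reg s 8 = inr c;
  rep_draws : draws s = d;
  rep_out : out s = o }.

Lemma frozenP s : bounded N s /\ cells s = M -> frozen s.
Proof. by move=> H; apply/asboolP. Qed.

Lemma nx_cat (T : eqType) (z a : T) (s1 s2 : seq T) :
  a \notin s1 -> nx z (s1 ++ a :: s2) a = head z s2.
Proof.
by move=> as1; rewrite /nx index_cat (negPf as1) /= eqxx addn0
  nth_cat ltnNge leqnSn subSnn /= nth0.
Qed.

(** Induction on the part [s2] still to be visited, with register 9 at its head; [s1] is already
    done. *)
Lemma runs_report_bucket c (s1 s2 : seq U) d o s Q :
  0 < c -> bucket X C c = s1 ++ s2 -> reporting c d o s ->
  reg s 9 = head null [seq inl a | a <- s2] ->
  (forall s', reporting c (d + size s2)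
     (o ++ emitted th d [seq (a, c) | a <- s2]) s' -> Q s') ->
  runs frozen report_bucket s Q.
Proof.
move=> c0; elim: s2 s1 d o s => [|a s2 IH] s1 d o s Eb rs r9 HQ.
  have [[bs cs] ls fs _ _ _ _ _ _ _] := rs; apply: runs_while_false.
  - rewrite /= r9 /= -fndSome; have := ls 0 null; rewrite (linked_cnt_num L) /look.
    by case E: (_.[? _]) => [w|//] /= w0; case: (fs (0, null)); rewrite E w0.
  - exact: frozenP.
  - by apply: HQ; rewrite addn0 cats0.
have inv := ss_invP X kt_gt0.
have ab : a \in bucket X C c by rewrite Eb mem_cat mem_head orbT.
have [Ca aX] : C.[? a] = Some c /\ a \in X.
  by move: ab; rewrite mem_bucket => /andP[/eqP].
have [fr ls fs r0 r1 r3 r7 r8 ds os] := rs.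
have [bs cs] := fr; apply: runs_while_true.
- rewrite /= r9 /= -fndSome; have := ls 0 (inl a).
  (* An empty cell would read as 0, whereas the counter is positive. *)
  by rewrite (linked_cnt L) /cnt Ca /look /=; case: (_.[? _]) => // -[E]; rewrite -E in c0.
- exact: frozenP.
apply/runs_seq/runs_op; first by apply: frozenP; split; first by case: bs.
set s' := op_eval _ _ _ _ s.
have b' : bounded N s' by case: bs.
have g9 : look s' 1 (reg s' 9) = head null [seq inl a | a <- s2].
  rewrite -[reg s' 9]/(reg s 9) -[look s' _ _]/(look s _ _) r9 ls (linked_nxt L) /=.
  rewrite /cnt Ca /= /chain Eb map_cat /= -cat_cons nx_cat //.
  have := uniq_chain X C c; rewrite /chain Eb map_cat -cat_cons cat_uniq /=.
  by move=> /and3P[_ /norP[]].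
apply: runs_op.
  apply: frozenP; split=> //; apply: bounded_set_reg => //.
  by rewrite -/(look s' 1 (reg s' 9)) g9; case: (s2).
apply: (IH (rcons s1 a) d.+1 (o ++ emitted th d [:: (a, c)])).
- by rewrite cat_rcons.
- split=> //=; rewrite ?reg_set_reg /setr //=.
  + by split=> //; apply: bounded_set_reg => //; rewrite -/(look s' 1 (reg s' 9)) g9; case: (s2).
  + by rewrite ds.
  rewrite r9 /= r8 r0 r1 r3 ds os /= div1r cats0 -/(gamma eps delta) -/th.
  by case: ifP; rewrite ?cats1 ?cats0.
- by rewrite reg_set_reg /setr /= -/(look s' 1 (reg s' 9)) g9.
by move=> s3; rewrite addSnnS /= cats0 -catA; exact: HQ.
Qed.

Lemma runs_report_buckets j c d o s Q :
  c + j = size X -> reporting c d o s ->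
  (forall s', reporting (size X) (d + size (enumeration X C (iota c.+1 j)))
     (o ++ emitted th d (enumeration X C (iota c.+1 j))) s' -> Q s') ->
  runs frozen
    (While (Lt 8 3) (Seq (Op (Add 8 8 7)) (Seq (Op (Get 9 1 8)) report_bucket)))
    s Q.
Proof.
elim: j c d o s => [|j IH] c d o s cj rs HQ.
  have [fr ls fs r0 r1 r3 r7 r8 ds os] := rs; apply: runs_while_false.
  - by rewrite /= r8 r3 /= -cj addn0 ltnn.
  - exact: frozenP.
  - by apply: HQ; rewrite -cj !addn0 cats0.
have [fr ls fs r0 r1 r3 r7 r8 ds os] := rs; have [bs cs] := fr.
have cN : c.+1 <= N by apply: leq_trans XN; rewrite -cj addnS ltnS leq_addr.
apply: runs_while_true.
- by rewrite /= r8 r3 /= -cj addnS ltnS leq_addr.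
- exact: frozenP.
have b1 : bounded N (set_reg s 8 (inr c.+1)) by apply: bounded_set_reg.
have hN : num (head null [seq inl a | a <- bucket X C c.+1]) <= N.
  by case: (bucket _ _ _).
apply/runs_seq/runs_op; rewrite /= r8 r7 /= addn1.
  by apply: frozenP; split.
have hE : odflt null (cells s).[? (1, reg (set_reg s 8 (inr c.+1)) 8)] =
    head null [seq inl a | a <- bucket X C c.+1].
  by rewrite -/(look s _ _) ls reg_set_reg /setr /= (linked_nxt L) /= nx_cons eqxx.
apply/runs_seq/runs_op; rewrite /= hE.
  by apply: frozenP; split=> //; apply: bounded_set_reg.
apply: (@runs_report_bucket c.+1 [::] (bucket X C c.+1) d o) => //.
- split=> //=; rewrite ?reg_set_reg /setr /= ?reg_set_reg /setr //=.
  by split=> //; apply: bounded_set_reg.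
- by rewrite reg_set_reg.
move=> s'; set d' := d + _; set o' := o ++ _ => rs'.
apply: (IH c.+1 d' o') => //; first by rewrite addSnnS.
move=> s3 rs3; apply: HQ.
rewrite /enumeration /= size_cat emitted_cat addnA catA size_map.
exact: rs3.
Qed.

Lemma runs_report s f :
  sim N s f g -> encodes k kt X f g -> cells s = M -> 0 < N ->
  runs frozen report s (fun s' =>
    out s' = emitted th 0 (enumeration X C (iota 1 (size X)))).
Proof.
move=> [bs rs ls fs ds os] [f0 f1 f3 _ _ _ _] cs N0.
apply/runs_seq/runs_op.
  by apply: frozenP; split=> //; apply: bounded_set_reg.
apply/runs_seq/runs_op.
  by apply: frozenP; split=> //; do 2 apply: bounded_set_reg => //.
apply: (@runs_report_buckets (size X) 0 0 [::]) => //.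
  split=> //=; rewrite ?reg_set_reg /setr /= ?reg_set_reg /setr /= ?rs //.
  by split=> //; do 2 apply: bounded_set_reg => //.
by move=> s' [].
Qed.

End Report.

(** * Implementation of DPSS and choice of the constants *)

Section Implementation.
Local Open Scope fset_scope.
Local Open Scope nat_scope.

Lemma bounded_fits (R : realType) (U : choiceType) N K m (s : state R U) :
  bounded N s -> #|` domf (cells s)| <= K -> width + 2 * K <= m -> fits m N s.
Proof.
move=> [sz br bc] cK Km; apply/and3P; split.
- by apply: leq_trans Km; rewrite /space leq_add // leq_mul2l.
- by apply/(all_nthP (inr 0)) => i _; exact: br.
apply/forallP => p.
by have [-> ->] := bc _ _ (esym (Some_fnd p)).
Qed.

Lemma update_report_DPSS (R : realType) (U : choiceType) (X : seq U) k kt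
    (eps delta : R) m t :
  0 < kt -> k <= size X -> kt <= size X -> cost update < t ->
  width + 2 * (4 * kt + 1 + cost update) <= m ->
  implements_DPSS update report m t X k kt eps delta.
Proof.
move=> kt0 kX ktX tP mP; set E := enumeration X (SS X kt) (iota 1 (size X)).
have inv := ss_invP X kt0.
(* Each counter is positive and at most the sum $|X|$ of all counters, so the range of the report
   misses none. *)
have EP a c : (a, c) \in E <-> (SS X kt).[? a] = Some c.
  rewrite mem_enumeration; split=> [/and3P[/eqP]//|Ca].
  rewrite Ca eqxx (ss_sub inv) -?fndSome ?Ca //= mem_iota add1n ltnS.
  by rewrite (ss_pos inv Ca) -(ss_sum inv) (fnd_le_sum Ca).
have uE : uniq (unzip1 E) by apply/uniq_enumeration/iota_uniq.
(* The draw of an item is its position in the report order, which the stream alone determines. *)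
exists (fun x => index x (unzip1 E)); split.
  have dE x : x \in domf (SS X kt) -> x \in unzip1 E.
    rewrite -fndSome; case Cx: (SS X kt).[? x] => [c|//] _.
    by apply/mapP; exists (x, c) => //; apply/EP.
  by move=> x y /dE xE /dE yE /(index_inj x xE yE).
move=> xi.
have X0 : 0 < size X by apply: leq_trans ktX.
have [trs [s [f [g [p z b ss es]]]]] := process_update eps delta xi (X := [::])
  kt0 ktX (leqnn _) (sim_init R U kX ktX) (encodes_init R U k kt).
have [tr [e a oE]] := runs_report eps delta xi kt0 (leqnn _) (enc_linked es)
  ss es erefl X0.
exists trs, s, tr; split=> //.
- by apply: sub_all z => u uz; apply: leq_trans tP.
- rewrite all_cat; apply/andP; split.
    by apply: sub_all b => s' /asboolP[bs cs]; apply: bounded_fits mP.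
  apply: sub_all a => s' /asboolP[bs cs]; apply: bounded_fits mP => //.
  rewrite cs (leq_trans (card_cells ss (ss_pos inv) (enc_linked es))) //.
  rewrite -addnA leq_add // ?leq_mul2l ?(ss_card inv) ?orbT //.
rewrite oE /=; split.
  exact: subseq_uniq (unzip1_emitted _ _ _ _) uE.
move=> x v; rewrite fnd_DPSS; split.
  move=> /(mem_emitted _ _ _ _ _ uE)[c [/EP -> -> H]].
  by rewrite /= add0n in H *; rewrite H.
case Cx: (SS X kt).[? x] => [c|//]; case: ifP => // H [<-].
by apply/(mem_emitted _ _ _ _ _ uE); exists c; split=> //; exact/EP.
Qed.

End Implementation.

Theorem theorem2 :
  exists (upd rep : cmd) (c : nat),
  forall (R : realType) (eps delta : R) (k n : nat),
    0 < eps -> 0 < delta -> delta < 1 -> (0 < k)%N ->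
    n%:R / (2 * k%:R) > 2 * (gamma eps delta + 1) ->
  exists kt : nat, (0 < kt)%N /\
  forall (U : choiceType) (X : seq U), size X = n ->
    implements_DPSS upd rep (c * k)%N c X k kt eps delta /\
    forall (d : measure_display) (Omega : measurableType d)
      (P : probability Omega R) (eta : U -> {RV P >-> R}),
      laplace_noise eps (domf (SS X kt)) eta ->
      let D := fun w : Omega => DPSS X k kt eps delta (fun x => eta x w) in
      (forall x : U,
         (P [set w | exists2 v, (D w).[? x] = Some v &
               ~ ((freq X x)%:R - eps^-1 * ln (delta^-1) <= v
                  <= (freq X x)%:R + (size X)%:R / (2 * k%:R)
                     + eps^-1 * ln (delta^-1))%R]
          <= delta%:E)%E) /\
      (forall y : U,
         (freq X y)%:R > (size X)%:R / k%:R :> R ->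
         ((1 - delta)%:E <= P [set w | y \in domf (D w)])%E).
Proof.
(* For [kt = 2k] the space bound is $16k+18$ plus twice the cost of an update, at most $k$ times
   this constant as $k\ge1$. *)
exists update, report, (34 + 2 * cost update)%N.
move=> R eps delta k n e0 d0 d1 k0 big; exists (2 * k)%N; split; first by lia.
move=> U X Xn; rewrite -Xn in big *.
have d01 : 0 < delta < 1 by rewrite d0.
have g0 : 0 < gamma eps delta.
  by rewrite mulr_gt0 ?invr_gt0 // ln_gt0 // ltr_pdivlMr // mul1r; lra.
(* Ensures that the inputs [k] and [2k] fit in words bounded by $|X|$. *)
have kX : (4 * k < size X)%N.
  rewrite -(ltr_nat R) natrM.
  have : 2 < (size X)%:R / (2 * k%:R) :> R by apply: lt_trans big; lra.
  by rewrite ltr_pdivlMr ?mulr_gt0 ?ltr0n //; lra.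
split.
  by apply: update_report_DPSS; rewrite /width; move: (cost update) => c; nia.
move=> d Omega P eta noise D; split=> [x|y hy].
  exact: DPSS_accuracy.
exact: DPSS_heavy.
Qed.
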